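(* Let $\mathbb{K}$ be a field of characteristic zero, let $\mathcal{C}$ be a generalized HW category over $\mathbb{K}$ with simple objects $L(0),L(1),L(2),\dots$, and let $M$ be an object of $\mathcal{C}$ which has a good filtration. With the convention $\mathrm{Min}\,\emptyset=\infty$, define $m(0)\le m(1)\le m(2)\le\cdots$ in $\mathbb{Z}_{\ge0}\cup\{\infty\}$ by $$m(0)=\mathrm{Min}\{n\in\mathbb{Z}_{\ge0}\mid\mathrm{Ext}^n_{\mathcal{C}}(L(0),M)=0\},\qquad m(k)=\mathrm{Min}\{n\ge m(k-1)\mid\mathrm{Ext}^n_{\mathcal{C}}(L(k),M)=0\}\ \ (k>0).$$ Then: (a) $\mathrm{Ext}^n_{\mathcal{C}}(L(k),M)=0$ for all $k\ge0$ and all integers $n\ge m(k)$. (b) If moreover $\mathcal{C}$ is a HW category, then $m(0)\le1$ and $m(k)\le1+m(k-1)$ for all $k>0$. In particular, all the $m(k)$ are finite when $\mathcal{C}$ is a HW category.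
   Context: A $\mathbb{K}$-linear abelian category $\mathcal{C}$ is a locally artinian (LA) category if (LA1) it admits direct limits of all directed families $A_0\to A_1\to A_2\to\cdots$ indexed by $\mathbb{Z}_{\ge0}$; (LA2) the functor $\varinjlim$ is exact; (LA3) every object is a directed union $\bigcup_{n\ge0}A_n$ (a direct limit of such a family with all maps injective) of subobjects $A_n$ of finite length. The socle $\mathrm{Soc}(X)$ is the largest semisimple subobject of $X$. An injective envelope of $X$ is an injective object $I\supseteq X$ with $\mathrm{Soc}\,I=\mathrm{Soc}\,X$. A filtration $\mathcal{G}_*$ of $M$ is a family of subobjects $\mathcal{G}_0M\subseteq\mathcal{G}_1M\subseteq\cdots$ with $M=\bigcup_n\mathcal{G}_nM$; its successive quotients are $\overline{\mathcal{G}}_nM=\mathcal{G}_nM/\mathcal{G}_{n-1}M$ ($\overline{\mathcal{G}}_0M=\mathcal{G}_0M$). An LA category $\mathcal{C}$ is an LA+ category if: (AX1) there is a set $\{L(n)\mid n\in\mathbb{Z}_{\ge0}\}$ of objects which is a complete list of pairwise nonisomorphic simple objects; (AX2) $\mathrm{End}_{\mathcal{C}}(L(n))=\mathbb{K}$ and $L(n)$ has an injective envelope $I(n)$, for all $n$; (AX3) for all $n$ the standard object $\nabla(n)$, defined next, has finite length. Let $\mathcal{C}(n)$ be the subcategory of objects having a filtration each of whose successive quotients is $0$ or isomorphic to $L(k)$ for some $k\le n$. For $M\in\mathcal{C}$, $\mathcal{F}_nM$ is the largest subobject of $M$ in $\mathcal{C}(n)$ ($\mathcal{F}_{-1}M=0$),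 and $\mathcal{F}_0M\subseteq\mathcal{F}_1M\subseteq\cdots$ is the canonical filtration of $M$. The standard object $\nabla(n)$ is the inverse image in $I(n)$ of $\mathcal{F}_{n-1}(I(n)/L(n))$. LA+ categories have enough injectives, so $\mathrm{Ext}$ is computed by injective resolutions. An extended $\nabla(n)$-object is an object having a filtration each of whose successive quotients is a direct sum of (from $0$ up to $\aleph_0$) copies of $\nabla(n)$. A filtration $\mathcal{G}_*$ of $M$ is good if for every $k$ the quotient $\overline{\mathcal{G}}_kM$ is an extended $\nabla(n)$-object for some $n=n(k)$. An LA+ category is a generalized HW category if (HW1) the canonical filtration of $I(n)$ is good for all $n\ge0$; it is a HW category if moreover (HW2) $\mathcal{F}_nI(n)=\nabla(n)$ for all $n\ge0$. *)

(* Defs.v *)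
From HB Require Import structures.
From mathcomp Require Import all_boot all_order all_algebra.
From mathcomp Require Import boolp.

Set Implicit Arguments.
Unset Strict Implicit.
Unset Printing Implicit Defensive.

Import GRing.Theory.
Local Open Scope ring_scope.

Declare Scope linCat_scope.
Delimit Scope linCat_scope with C.

Record linCat (K : fieldType) := LinCat {
  obj :> Type;
  hom : obj -> obj -> lmodType K;
  idm : forall X, hom X X;
  comp : forall X Y Z, hom Y Z -> hom X Y -> hom X Z;
  compA : forall X Y Z T (h : hom Z T) (g : hom Y Z) (f : hom X Y),
    comp h (comp g f) = comp (comp h g) f;
  comp1m : forall X Y (f : hom X Y), comp (idm Y) f = f;
  compm1 : forall X Y (f : hom X Y), comp f (idm X) = f;
  comp_linl : forall X Y Z (a : K) (g g' : hom Y Z) (f : hom X Y),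
    comp (a *: g + g') f = a *: comp g f + comp g' f;
  comp_linr : forall X Y Z (a : K) (g : hom Y Z) (f f' : hom X Y),
    comp g (a *: f + f') = a *: comp g f + comp g f'
}.

Arguments hom {K} [C] X Y : rename.
Arguments idm {K} [C] X : rename.
Arguments comp {K} [C X Y Z] g f : rename.

Notation "g \c f" := (comp g f) (at level 40, left associativity)
  : linCat_scope.
Open Scope linCat_scope.

Section Categories.
Context {K : fieldType} {C : linCat K}.
Implicit Types A B X Y Z M : C.

Definition mono X Y (f : hom X Y) : Prop :=
  forall T (u v : hom T X), f \c u = f \c v -> u = v.

Definition epi X Y (f : hom X Y) : Prop :=
  forall T (u v : hom Y T), u \c f = v \c f -> u = v.

Definition iso X Y (f : hom X Y) : Prop :=
  exists g : hom Y X, g \c f = idm X /\ f \c g = idm Y.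

Definition isomorphic X Y : Prop := exists f : hom X Y, iso f.

(* Initial and terminal: a hom-space always contains 0, so it is a singleton
   exactly when all its elements are 0. *)
Definition is_zero X : Prop :=
  forall Y, (forall f : hom X Y, f = 0) /\ (forall f : hom Y X, f = 0).

Definition is_kernel X Y (f : hom X Y) A (k : hom A X) : Prop :=
  f \c k = 0 /\
  forall T (t : hom T X), f \c t = 0 -> exists! u : hom T A, k \c u = t.

Definition is_cokernel X Y (f : hom X Y) Q (q : hom Y Q) : Prop :=
  q \c f = 0 /\
  forall T (t : hom Y T), t \c f = 0 -> exists! u : hom Q T, u \c q = t.

Definition is_image X Y (f : hom X Y) A (i : hom A Y) : Prop :=
  exists (Q : C) (q : hom Y Q), is_cokernel f q /\ is_kernel q i.

Definition exact X Y Z (f : hom X Y) (g : hom Y Z) : Prop :=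
  exists (A : C) (i : hom A Y), is_image f i /\ is_kernel g i.

Definition short_exact X Y Z (f : hom X Y) (g : hom Y Z) : Prop :=
  is_kernel g f /\ is_cokernel f g.

Definition is_biproduct X Y S (i1 : hom X S) (i2 : hom Y S)
    (p1 : hom S X) (p2 : hom S Y) : Prop :=
  [/\ p1 \c i1 = idm X, p2 \c i2 = idm Y, p1 \c i2 = 0, p2 \c i1 = 0
    & i1 \c p1 + i2 \c p2 = idm S].

Definition is_pullback X Y Z (f : hom X Z) (g : hom Y Z)
    P (p : hom P X) (q : hom P Y) : Prop :=
  f \c p = g \c q /\
  forall T (u : hom T X) (v : hom T Y), f \c u = g \c v ->
    exists! w : hom T P, p \c w = u /\ q \c w = v.

Definition is_coproduct (J : Type) (F : J -> C) S
    (i : forall j, hom (F j) S) : Prop :=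
  forall T (t : forall j, hom (F j) T),
    exists! u : hom S T, forall j, u \c i j = t j.

Definition is_colimit (A : nat -> C) (a : forall n, hom (A n) (A n.+1))
    X (x : forall n, hom (A n) X) : Prop :=
  (forall n, x n.+1 \c a n = x n) /\
  forall T (t : forall n, hom (A n) T), (forall n, t n.+1 \c a n = t n) ->
    exists! u : hom X T, forall n, u \c x n = t n.

(* Meant for monomorphisms a and b, which represent subobjects of X. *)
Definition sub_le X A B (a : hom A X) (b : hom B X) : Prop :=
  exists h : hom A B, b \c h = a.

(* a : A -> X is the largest among the subobjects of X whose source
   satisfies P. *)
Definition is_largest_sub (P : C -> Prop) X A (a : hom A X) : Prop :=
  [/\ mono a, P A
    & forall B (b : hom B X), mono b -> P B -> sub_le b a].

Definition simple X : Prop :=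
  ~ is_zero X /\ forall A (a : hom A X), mono a -> is_zero A \/ iso a.

Definition semisimple X : Prop :=
  exists (J : Type) (F : J -> C) (i : forall j, hom (F j) X),
    (forall j, simple (F j)) /\ is_coproduct i.

Definition is_socle X S (s : hom S X) : Prop := is_largest_sub semisimple s.

Inductive finite_length : C -> Prop :=
| FiniteLength0 X : is_zero X -> finite_length X
| FiniteLengthS A X S (i : hom A X) (p : hom X S) :
    finite_length A -> simple S -> short_exact i p -> finite_length X.

Definition injective_obj I : Prop :=
  forall A B (a : hom A B) (f : hom A I), mono a ->
    exists g : hom B I, g \c a = f.

Definition injective_envelope X I (i : hom X I) : Prop :=
  [/\ injective_obj I, mono i
    & exists (S : C) (s : hom S X), is_socle s /\ is_socle (i \c s)].

Record filtration M := Filtration {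
  fil :> nat -> C;
  fil_in : forall n, hom (fil n) M;
  fil_step : forall n, hom (fil n) (fil n.+1);
  fil_in_mono : forall n, mono (fil_in n);
  fil_union : is_colimit fil_step fil_in
}.

(* Quotients are determined up to isomorphism only, so Q ranges over all
   representatives of the n-th one. *)
Definition is_succ_quotient M (G : filtration M) (n : nat) Q : Prop :=
  match n with
  | 0 => isomorphic (G 0) Q
  | n'.+1 => exists q : hom (G n'.+1) Q, is_cokernel (fil_step G n') q
  end.

Record injective_resolution M := InjectiveResolution {
  res : nat -> C;
  res_aug : hom M (res 0);
  res_d : forall n, hom (res n) (res n.+1);
  res_inj : forall n, injective_obj (res n);
  res_aug_mono : mono res_aug;
  res_exact0 : exact res_aug (res_d 0);
  res_exactS : forall n, exact (res_d n) (res_d n.+1)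
}.

Definition Ext_cocycle M (R : injective_resolution M) X n
  (f : hom X (res R n)) : Prop := res_d R n \c f = 0.

Definition Ext_coboundary M (R : injective_resolution M) X n :
    hom X (res R n) -> Prop :=
  match n with
  | 0 => fun f => f = 0
  | n'.+1 => fun f => exists g : hom X (res R n'), res_d R n' \c g = f
  end.

(* Ext^n(X, M) = 0, where Ext^n(X, M) is the n-th cohomology of Hom(X, R) for
   an injective resolution R of M; its vanishing does not depend on R. *)
Definition Ext_zero (n : nat) X M : Prop :=
  exists R : injective_resolution M,
    forall f : hom X (res R n), Ext_cocycle f -> Ext_coboundary f.

End Categories.

Arguments Ext_zero {K C} n X M.

Record abelian (K : fieldType) (C : linCat K) : Prop := Abelian {
  ab_zero : exists Z : C, is_zero Z;
  ab_sum : forall X Y : C, exists (S : C) (i1 : hom X S) (i2 : hom Y S)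
    (p1 : hom S X) (p2 : hom S Y), is_biproduct i1 i2 p1 p2;
  ab_ker : forall (X Y : C) (f : hom X Y),
    exists (A : C) (k : hom A X), is_kernel f k;
  ab_coker : forall (X Y : C) (f : hom X Y),
    exists (Q : C) (q : hom Y Q), is_cokernel f q;
  ab_mono : forall (X Y : C) (f : hom X Y), mono f ->
    exists (Z : C) (g : hom Y Z), is_kernel g f;
  ab_epi : forall (X Y : C) (f : hom X Y), epi f ->
    exists (Z : C) (g : hom Z X), is_cokernel g f
}.

Record locally_artinian (K : fieldType) (C : linCat K) : Prop := LA {
  LA_abelian : abelian C;
  LA1 : forall (A : nat -> C) (a : forall n, hom (A n) (A n.+1)),
    exists (X : C) (x : forall n, hom (A n) X), is_colimit a x;
  LA2 : forall (A B D : nat -> C) (a : forall n, hom (A n) (A n.+1))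
      (b : forall n, hom (B n) (B n.+1)) (d : forall n, hom (D n) (D n.+1))
      (f : forall n, hom (A n) (B n)) (g : forall n, hom (B n) (D n))
      (X Y Z : C) (x : forall n, hom (A n) X) (y : forall n, hom (B n) Y)
      (z : forall n, hom (D n) Z) (F : hom X Y) (G : hom Y Z),
    (forall n, f n.+1 \c a n = b n \c f n) ->
    (forall n, g n.+1 \c b n = d n \c g n) ->
    (forall n, short_exact (f n) (g n)) ->
    is_colimit a x -> is_colimit b y -> is_colimit d z ->
    (forall n, F \c x n = y n \c f n) -> (forall n, G \c y n = z n \c g n) ->
    short_exact F G;
  LA3 : forall X : C, exists G : filtration X, forall n, finite_length (G n)
}.

Section Standard.
Context {K : fieldType} {C : linCat K}.
(* L n stands for the simple object L(n), and iota n for its inclusion into an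
   injective envelope I(n). *)
Variables (L I : nat -> C) (iota : forall n, hom (L n) (I n)).

Definition in_Cle (n : nat) (X : C) : Prop :=
  exists G : filtration X, forall j, exists Q : C, is_succ_quotient G j Q /\
    (is_zero Q \/ exists2 k : nat, (k <= n)%N & isomorphic Q (L k)).

(* a : A -> X is the inclusion of the n-th term of the canonical filtration
   of X. *)
Definition is_canon (n : nat) (X A : C) (a : hom A X) : Prop :=
  is_largest_sub (in_Cle n) a.

(* The (n-1)-st term, the (-1)-st one being 0. *)
Definition is_canon_pred (n : nat) (X A : C) (a : hom A X) : Prop :=
  match n with
  | 0 => is_zero A
  | n'.+1 => is_canon n' a
  end.

(* nabla(n) as a subobject v of I(n): the pullback along q : I(n) -> I(n)/L(n)
   of the (n-1)-st canonical subobject w of I(n)/L(n). *)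
Definition is_standard (n : nat) (V : C) (v : hom V (I n)) : Prop :=
  exists (Q : C) (q : hom (I n) Q) (W : C) (w : hom W Q) (r : hom V W),
    [/\ is_cokernel (iota n) q, is_canon_pred n w & is_pullback q w v r].

End Standard.

(* The objects L(n), I(n) and nabla(n) are determined up to isomorphism by C;
   an LAplus structure includes a choice of representatives simp, env and
   nabla. *)
Record LAplus (K : fieldType) (C : linCat K) := LAPlus {
  LAp_LA : locally_artinian C;
  simp : nat -> C;
  simp_simple : forall n, simple (simp n);
  simp_neq : forall n n', isomorphic (simp n) (simp n') -> n = n';
  simp_all : forall X : C, simple X -> exists n, isomorphic X (simp n);
  simp_end : forall n, bijective (fun c : K => c *: idm (simp n));
  env : nat -> C;
  env_in : forall n, hom (simp n) (env n);
  envP : forall n, injective_envelope (env_in n);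
  nabla : nat -> C;
  nabla_in : forall n, hom (nabla n) (env n);
  nablaP : forall n, is_standard env_in (nabla_in n);
  nabla_finite : forall n, finite_length (nabla n)
}.

Section HighestWeight.
Context {K : fieldType} {C : linCat K} (D : LAplus C).

(* A countType may be empty, finite or countably infinite. *)
Definition is_sum_of_copies (N X : C) : Prop :=
  exists (J : countType) (i : J -> hom N X), is_coproduct i.

Definition extended_nabla (n : nat) (X : C) : Prop :=
  exists G : filtration X, forall j, exists Q : C,
    is_succ_quotient G j Q /\ is_sum_of_copies (nabla D n) Q.

Definition good (M : C) (G : filtration M) : Prop :=
  forall k, exists (n : nat) (Q : C),
    is_succ_quotient G k Q /\ extended_nabla n Q.

Definition canonical (M : C) (G : filtration M) : Prop :=
  forall n, is_canon (simp D) n (fil_in G n).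

Definition HW1 : Prop :=
  forall n, exists2 G : filtration (env D n), canonical G & good G.

(* The subobject nabla(n) of I(n) is the n-th term of the canonical
   filtration of I(n). *)
Definition HW2 : Prop := forall n, is_canon (simp D) n (nabla_in D n).

Definition generalized_HW_category : Prop := HW1.
Definition HW_category : Prop := HW1 /\ HW2.

End HighestWeight.

(* None is infinity. *)
Definition natbar := option nat.

Definition le_natbar (x y : natbar) : bool :=
  match x, y with
  | _, None => true
  | None, Some _ => false
  | Some a, Some b => (a <= b)%N
  end.

Definition succ_natbar (x : natbar) : natbar := omap succn x.

Definition Min (P : nat -> Prop) : natbar :=
  match pselect (exists n, `[< P n >]) with
  | left h => Some (ex_minn h)
  | right _ => None
  end.

Fixpoint mseq (K : fieldType) (C : linCat K) (D : LAplus C) (M : C) (k : nat)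
    : natbar :=
  match k with
  | 0 => Min (fun n => Ext_zero n (simp D 0) M)
  | k'.+1 => Min (fun n => le_natbar (mseq D M k') (Some n) /\
                           Ext_zero n (simp D k'.+1) M)
  end.

(* Main.v *)
Require Import Defs.
From HB Require Import structures.
From mathcomp Require Import all_boot all_order all_algebra.
From mathcomp Require Import boolp.
(* [hom] also names a construction on vector spaces. *)
Import Defs.

(** Write [F_k M] for the largest subobject of [M] all of whose composition
    factors are among the [L j] with [j < k]. The idea is that an object with a
    good filtration is acyclic for each functor [F_k]: there is an exact sequence
    [M' -> M -> M''] in which [M'] has its factors among the [L j], [j < k], and
    [Ext^n(L j, M'') = 0] for all [n] and all [j < k]. This is the predicate
    [acyc], and everything is deduced from it.

    Why good filtrations imply it. The object [nabla n] sits inside the injective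
    [I n], and by [HW1] the quotient is filtered by objects [nabla m] with
    [m >= n]. Shifting degrees along [nabla n -> I n] gives, by induction on the
    degree, [Ext^i(L j, nabla n) = 0] for all [j < n] and all [i]
    ([nabla_ev]). So [nabla n] is acyclic, and acyclicity is inherited by
    extensions ([acyc_ext]) and unions ([acyc_union]), hence by objects with a
    good filtration ([acyc_good]) and by the [I n] ([acyc_env]). Every object
    embeds into a union of finite sums of the [I n]; such a union is injective
    because the category is locally noetherian ([inj_union]), and it is acyclic.
    Cokernels of maps between acyclic objects are acyclic when the map is a
    monomorphism ([acyc_coker]), so acyclic objects have acyclic cosyzygies.

    Part (a) then reduces, by passing to a cosyzygy, to the case where
    [Ext^1(L j, M) = 0] for all [j < k]. Then [F_k M] is injective relative to
    objects with factors [L j], [j < k], so for an acyclic injective [J] that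
    contains [M] it is a direct summand of [F_k J] ([splitting_retract]). The
    group [Ext^i(L j, F_k J)] is [Ext^i(L j, J) = 0] for [i >= 1], which gives the
    vanishing for [F_k M], and with it for [M] ([ev_of_ev1], [acyc_vanish]).

    For part (b), [HW2] makes [nabla k] injective relative to objects with
    factors [L j], [j <= k] ([nabla_extends]). Therefore [Ext^1(L k, Q) = 0] whenever [Q] has such
    factors and its socle consists of copies of [L k] ([socle_split]). It follows
    that [Ext^i(L k, M / F_k M) = 0] for [i >= 1] ([splitting_next]), and the
    argument of part (a), applied to [Ext^2(L k, -)] and the summand [F_k M] of
    [F_k J], raises the vanishing of [Ext^n(L j, M)] for [j < k] to that of
    [Ext^(n+1)(L k, M)] ([acyc_next]).

    Vanishing of Ext is handled by dimension shifting ([ev]), and agrees with the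
    definition by injective resolutions ([Ext_zeroP]). *)

Set Implicit Arguments.
Unset Strict Implicit.
Unset Printing Implicit Defensive.

Import GRing.Theory.
Local Open Scope ring_scope.

(** * Linear categories *)

Section Linear.
Context {K : fieldType} {C : linCat K}.
Implicit Types A B X Y Z M T : C.

Lemma compDl X Y Z (g g' : hom Y Z) (f : hom X Y) :
  (g + g') \c f = g \c f + g' \c f.
Proof. by have := comp_linl 1 g g' f; rewrite !scale1r. Qed.

Lemma compDr X Y Z (g : hom Y Z) (f f' : hom X Y) :
  g \c (f + f') = g \c f + g \c f'.
Proof. by have := comp_linr 1 g f f'; rewrite !scale1r. Qed.

Lemma comp0l X Y Z (f : hom X Y) : (0 : hom Y Z) \c f = 0.
Proof. by apply: (addrI (0 \c f)); rewrite -compDl !addr0. Qed.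

Lemma comp0r X Y Z (g : hom Y Z) : g \c (0 : hom X Y) = 0.
Proof. by apply: (addrI (g \c 0)); rewrite -compDr !addr0. Qed.

Lemma compNl X Y Z (g : hom Y Z) (f : hom X Y) : (- g) \c f = - (g \c f).
Proof. by apply: (addrI (g \c f)); rewrite -compDl !subrr comp0l. Qed.

Lemma compNr X Y Z (g : hom Y Z) (f : hom X Y) : g \c (- f) = - (g \c f).
Proof. by apply: (addrI (g \c f)); rewrite -compDr !subrr comp0r. Qed.

Lemma compBl X Y Z (g g' : hom Y Z) (f : hom X Y) :
  (g - g') \c f = g \c f - g' \c f.
Proof. by rewrite compDl compNl. Qed.

Lemma compBr X Y Z (g : hom Y Z) (f f' : hom X Y) :
  g \c (f - f') = g \c f - g \c f'.
Proof. by rewrite compDr compNr. Qed.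

(** Composites are kept associated to the left, so an equation between
    composites has to be applied below a further arrow on the left. *)
Lemma postE X Y Z T (g : hom Y Z) (f : hom X Y) (h : hom X Z) (t : hom Z T) :
  g \c f = h -> t \c g \c f = t \c h.
Proof. by move=> <-; rewrite compA. Qed.

Lemma mono0 X Y (f : hom X Y) :
  (forall T (t : hom T X), f \c t = 0 -> t = 0) -> mono f.
Proof.
by move=> f0 T u v /eqP; rewrite -subr_eq0 -compBr => /eqP/f0/subr0_eq.
Qed.

Lemma mono_eq0 X Y (f : hom X Y) T (t : hom T X) : mono f -> f \c t = 0 -> t = 0.
Proof. by move=> fm ft; apply: fm; rewrite ft comp0r. Qed.

Lemma epi0 X Y (f : hom X Y) :
  (forall T (t : hom Y T), t \c f = 0 -> t = 0) -> epi f.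
Proof.
by move=> f0 T u v /eqP; rewrite -subr_eq0 -compBl => /eqP/f0/subr0_eq.
Qed.

Lemma epi_eq0 X Y (f : hom X Y) T (t : hom Y T) : epi f -> t \c f = 0 -> t = 0.
Proof. by move=> fm ft; apply: fm; rewrite ft comp0l. Qed.

Lemma mono_comp X Y Z (g : hom Y Z) (f : hom X Y) :
  mono g -> mono f -> mono (g \c f).
Proof. by move=> gm fm T u v; rewrite -!compA => /gm/fm. Qed.

Lemma mono_compr X Y Z (g : hom Y Z) (f : hom X Y) : mono (g \c f) -> mono f.
Proof. by move=> gf T u v E; apply: gf; rewrite -!compA E. Qed.

Lemma epi_comp X Y Z (g : hom Y Z) (f : hom X Y) :
  epi g -> epi f -> epi (g \c f).
Proof. by move=> gm fm T u v; rewrite !compA => /fm/gm. Qed.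

Lemma epi_compl X Y Z (g : hom Y Z) (f : hom X Y) : epi (g \c f) -> epi g.
Proof. by move=> gf T u v E; apply: gf; rewrite !compA E. Qed.

Lemma iso_mono X Y (f : hom X Y) : iso f -> mono f.
Proof.
by case=> g [gf _] T u v /(congr1 (comp g)); rewrite !compA gf !comp1m.
Qed.

Lemma iso_epi X Y (f : hom X Y) : iso f -> epi f.
Proof.
by case=> g [_ fg] T u v /(congr1 (fun h => h \c g)); rewrite -!compA fg !compm1.
Qed.

Lemma iso_id X : iso (idm X).
Proof. by exists (idm X); rewrite comp1m. Qed.

Lemma zeroP X : is_zero X <-> idm X = 0.
Proof.
split=> [/(_ X) [_]//|X0 Y]; split=> f.
- by rewrite -[f]compm1 X0 comp0r.
- by rewrite -[f]comp1m X0 comp0l.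
Qed.

Lemma zero_src X Y (f : hom X Y) : is_zero X -> f = 0.
Proof. by case/(_ Y). Qed.

Lemma zero_tgt X Y (f : hom Y X) : is_zero X -> f = 0.
Proof. by case/(_ Y). Qed.

Lemma zero_mono X Y (f : hom X Y) : is_zero X -> mono f.
Proof. by move=> X0; apply: mono0 => T t _; apply: zero_tgt. Qed.

Lemma mono_zero X Y (f : hom X Y) : mono f -> f = 0 -> is_zero X.
Proof. by move=> fm f0; apply/zeroP/fm; rewrite f0 !comp0l. Qed.

Lemma epi_zero X Y (f : hom X Y) : epi f -> f = 0 -> is_zero Y.
Proof. by move=> fm f0; apply/zeroP/fm; rewrite f0 !comp0r. Qed.

Lemma sub_zero X Y (f : hom X Y) : mono f -> is_zero Y -> is_zero X.
Proof. by move=> fm Y0; apply: mono_zero fm _; apply: zero_tgt. Qed.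

Lemma kernel_mono X Y (f : hom X Y) A (k : hom A X) : is_kernel f k -> mono k.
Proof.
case=> fk0 U T u v E.
have fv : f \c (k \c v) = 0 by rewrite compA fk0 comp0l.
by case: (U _ _ fv) => w [_ w1]; rewrite -(w1 u E) -(w1 v erefl).
Qed.

Lemma cokernel_epi X Y (f : hom X Y) A (k : hom Y A) : is_cokernel f k -> epi k.
Proof.
case=> fk0 U T u v E.
have fv : (v \c k) \c f = 0 by rewrite -compA fk0 comp0r.
by case: (U _ _ fv) => w [_ w1]; rewrite -(w1 u E) -(w1 v erefl).
Qed.

Lemma kernelI X Y (f : hom X Y) A (k : hom A X) :
  f \c k = 0 -> mono k ->
  (forall T (t : hom T X), f \c t = 0 -> exists u, k \c u = t) -> is_kernel f k.
Proof.
move=> fk km U; split=> // T t /U [u ku]; exists u; split=> // u' ku'.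
by apply: km; rewrite ku ku'.
Qed.

Lemma cokernelI X Y (f : hom X Y) A (k : hom Y A) :
  k \c f = 0 -> epi k ->
  (forall T (t : hom Y T), t \c f = 0 -> exists u, u \c k = t) ->
  is_cokernel f k.
Proof.
move=> fk km U; split=> // T t /U [u ku]; exists u; split=> // u' ku'.
by apply: km; rewrite ku ku'.
Qed.

Section Exact.
Variables (X Y Z : C) (i : hom X Y) (p : hom Y Z).
Hypothesis ip : short_exact i p.

Lemma se_mono : mono i. Proof. by case: ip => /kernel_mono. Qed.
Lemma se_epi : epi p. Proof. by case: ip => _ /cokernel_epi. Qed.
Lemma se_0 : p \c i = 0. Proof. by case: ip => -[]. Qed.

Lemma se_lift T (t : hom T Y) : p \c t = 0 -> exists u, i \c u = t.
Proof. by case: ip => -[_ U] _ /U [u [iu _]]; exists u. Qed.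

Lemma se_desc T (t : hom Y T) : t \c i = 0 -> exists u, u \c p = t.
Proof. by case: ip => _ [_ U] /U [u [iu _]]; exists u. Qed.

End Exact.

Lemma iso_cokernel X Y Z (f : hom X Y) (q : hom Y Z) W (g : hom Z W) :
  is_cokernel f q -> iso g -> is_cokernel f (g \c q).
Proof.
move=> [qf U] ig; apply: cokernelI.
- by rewrite (postE _ qf) comp0r.
- by apply: epi_comp (iso_epi ig) _; apply: cokernel_epi (conj qf U).
move=> T t /U [u [uq _]]; case: ig => h [hg gh]; exists (u \c h).
by rewrite compA (postE _ hg) compm1.
Qed.

End Linear.

(** * Abelian categories *)

Section Abelian.
Context {K : fieldType} {C : linCat K} (HA : abelian C).
Implicit Types A B X Y Z M N T : C.

Lemma mono_se X Y (i : hom X Y) :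
  mono i -> exists Z (p : hom Y Z), short_exact i p.
Proof.
move=> im; case: (ab_coker HA i) => Q [q qc]; exists Q, q; split=> //.
case: (ab_mono HA im) => Z [g [gi U]]; case: qc => qi qU.
apply: kernelI => // T t qt; case: (qU _ g gi) => u [uq _].
have gt : g \c t = 0 by rewrite -uq -compA qt comp0r.
by case: (U _ _ gt) => w [iw _]; exists w.
Qed.

Lemma epi_se X Y (p : hom X Y) :
  epi p -> exists A (i : hom A X), short_exact i p.
Proof.
move=> pe; case: (ab_ker HA p) => A [i ik]; exists A, i; split=> //.
case: (ab_epi HA pe) => Z [g [pg U]]; case: ik => pi kU.
apply: cokernelI => // T t ti; case: (kU _ g pg) => u [iu _].
have tg : t \c g = 0 by rewrite -iu compA ti comp0l.
by case: (U _ _ tg) => w [wp _]; exists w.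
Qed.

Lemma mono_epi_iso X Y (f : hom X Y) : mono f -> epi f -> iso f.
Proof.
move=> fm fe; case: (mono_se fm) => Z [p fp].
have p0 : p = 0 by apply: epi_eq0 fe _; apply: se_0 fp.
have p1 : p \c idm Y = 0 by rewrite p0 comp0l.
case: (se_lift fp p1) => g fg; exists g; split=> //.
by apply: fm; rewrite compA fg comp1m compm1.
Qed.

(** An epimorphism is the cokernel of its kernel, so a pair [i], [p] is exact
    as soon as [i] is a kernel of the epimorphism [p]. *)
Lemma seI X Y Z (i : hom X Y) (p : hom Y Z) :
  p \c i = 0 -> mono i -> epi p ->
  (forall T (t : hom T Y), p \c t = 0 -> exists u, i \c u = t) ->
  short_exact i p.
Proof.
move=> pi im pe U; split; first exact: kernelI.
apply: cokernelI => // T t ti; case: (epi_se pe) => A [k kp].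
apply: (se_desc kp); case: (U _ k (se_0 kp)) => u <-.
by rewrite compA ti comp0l.
Qed.

Lemma coker_se X Y Z (i : hom X Y) (p : hom Y Z) :
  mono i -> is_cokernel i p -> short_exact i p.
Proof.
move=> im pc; split=> //; case: (mono_se im) => Q [q iq].
case: (pc) => pi U; apply: kernelI => // T t pt; apply: (se_lift iq).
have qi := se_0 iq; case: (U _ q qi) => u [<- _].
by rewrite -compA pt comp0r.
Qed.

Lemma image X Y (f : hom X Y) :
  exists A (m : hom A Y) (e : hom X A), [/\ mono m, epi e & m \c e = f].
Proof.
case: (ab_coker HA f) => Q [c cc]; case: (ab_ker HA c) => A [m mk].
have mm := kernel_mono mk.
case: (mk) => cm mU; case: (cc) => cf cU.
case: (mU _ f cf) => e [me _]; exists A, m, e; split=> //.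
apply: epi0 => T t te; case: (ab_ker HA t) => B [k kk].
have km := kernel_mono kk; case: kk => tk kU.
case: (kU _ e te) => e' [ke' _].
case: (mono_se (mono_comp mm km)) => R [g gk].
have gf : g \c f = 0.
  by rewrite -me -ke' !compA -(compA g m k) (se_0 gk) comp0l.
case: (cU _ g gf) => g' [g'c _].
have gm : g \c m = 0 by rewrite -g'c -compA cm comp0r.
case: (se_lift gk gm) => s; rewrite -compA -[X in _ = X]compm1 => /mm ks.
by rewrite -[t]compm1 -ks compA tk comp0l.
Qed.

Lemma pullback X Y Z (f : hom X Z) (g : hom Y Z) :
  exists P (p : hom P X) (q : hom P Y), is_pullback f g p q.
Proof.
case: (ab_sum HA X Y) => S [i1 [i2 [p1 [p2 [E11 E22 E12 E21 E]]]]].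
case: (ab_ker HA (f \c p1 - g \c p2)) => P [k kk].
have km := kernel_mono kk; case: kk => k0 U.
exists P, (p1 \c k), (p2 \c k); split.
  by apply/subr0_eq; rewrite !compA -compBl.
move=> T u v fg.
have t0 : (f \c p1 - g \c p2) \c (i1 \c u + i2 \c v) = 0.
  rewrite compBl !compDr !compA !(postE _ E11, postE _ E22, postE _ E12, postE _ E21).
  by rewrite !comp0r !compm1 !comp0l addr0 add0r fg subrr.
case: (U _ _ t0) => w [kw _]; exists w; split; last first.
  move=> w' [p1w p2w]; apply: km.
  by rewrite kw -p1w -p2w !compA -!compDl -[k in X in _ = X]comp1m -E !compDl.
rewrite -!compA kw !compDr !compA E11 E22 E12 E21.
by rewrite !comp0l !comp1m addr0 add0r.
Qed.

(** Arrows into [Y] play the role of elements: along an epimorphism [p] they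
    lift after passing to an epimorphic cover of their source. *)
Lemma epi_cover Y N T (p : hom Y N) (t : hom T N) :
  epi p -> exists T' (e : hom T' T) (u : hom T' Y), epi e /\ p \c u = t \c e.
Proof.
move=> pe; case: (ab_sum HA Y T) => S [i1 [i2 [p1 [p2 [E11 E22 E12 E21 E]]]]].
have se : epi (p \c p1 - t \c p2).
  apply: (@epi_compl _ _ _ _ _ _ i1).
  by rewrite compBl !(postE _ E11, postE _ E21) comp0r subr0 compm1.
case: (epi_se se) => P [k kk]; exists P, (p2 \c k), (p1 \c k); split; last first.
  by apply/subr0_eq; rewrite !compA -compBl (se_0 kk).
apply: epi0 => Z s; rewrite compA => sk; case: (se_desc kk sk) => w ws.
have w0 : w = 0.
  apply: epi_eq0 pe _; transitivity (s \c p2 \c i1).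
    rewrite -ws compBr compBl !compA !(postE _ E11, postE _ E21).
    by rewrite comp0r subr0 compm1.
  by rewrite (postE _ E21) comp0r.
by rewrite -[s]compm1 -E22 compA -ws w0 !comp0l.
Qed.

Lemma pullback_epi X Y Z (f : hom X Z) (g : hom Y Z) P (p : hom P X) (q : hom P Y) :
  is_pullback f g p q -> epi f -> epi q.
Proof.
case=> E U fe; case: (epi_cover g fe) => T [e [u [ee fu]]].
by case: (U _ _ _ fu) => w [[_ qw] _]; apply: (@epi_compl _ _ _ _ _ _ w); rewrite qw.
Qed.

Lemma pullback_mono X Y Z (f : hom X Z) (g : hom Y Z) P (p : hom P X) (q : hom P Y) :
  is_pullback f g p q -> mono g -> mono p.
Proof.
case=> E U gm; apply: mono0 => T t pt.
have qt : q \c t = 0 by apply: mono_eq0 gm _; rewrite compA -E -compA pt comp0r.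
have E0 : f \c (0 : hom T X) = g \c 0 by rewrite !comp0r.
case: (U _ _ _ E0) => w [_ w1]; rewrite -(w1 t) //; apply: w1.
by rewrite !comp0r.
Qed.

Lemma pullback_se M Y N X (i : hom M Y) (p : hom Y N) (f : hom X N)
    P (a : hom P Y) (b : hom P X) :
  short_exact i p -> is_pullback p f a b ->
  exists k : hom M P, short_exact k b /\ a \c k = i.
Proof.
move=> ip pb; have be := pullback_epi pb (se_epi ip); case: (pb) => E U.
have E0 : p \c i = f \c 0 by rewrite (se_0 ip) comp0r.
case: (U _ _ _ E0) => k [[ak bk] _]; exists k; split=> //; apply: seI => //.
  by apply: (@mono_compr _ _ _ _ _ a); rewrite ak; apply: se_mono ip.
move=> T t bt; have pat : p \c (a \c t) = 0 by rewrite compA E -compA bt comp0r.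
case: (se_lift ip pat) => u iu; exists u.
have E1 : p \c (a \c t) = f \c 0 by rewrite pat comp0r.
case: (U _ _ _ E1) => w [_ w1]; rewrite -(w1 t) //; apply/esym/w1.
by rewrite !compA ak bk comp0l.
Qed.

(** The third isomorphism theorem, for [M <= Y <= J]. *)
Lemma se_comp M Y N J Z W (i : hom M Y) (p : hom Y N) (u : hom Y J)
    (q : hom J Z) (r : hom J W) :
  short_exact i p -> short_exact u q -> short_exact (u \c i) r ->
  exists (a : hom N W) (b : hom W Z),
    [/\ short_exact a b, a \c p = r \c u & b \c r = q].
Proof.
move=> ip uq ur.
have ru0 : r \c u \c i = 0 by rewrite -compA (se_0 ur).
case: (se_desc ip ru0) => a ap.
have q0 : q \c (u \c i) = 0 by rewrite compA (se_0 uq) comp0l.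
case: (se_desc ur q0) => b br; exists a, b; split=> //.
have E : b \c a = 0.
  by apply: epi_eq0 (se_epi ip) _; rewrite -compA ap compA br (se_0 uq).
apply: seI => //.
- apply: mono0 => T t at0; case: (epi_cover t (se_epi ip)) => T' [e [v [ee pv]]].
  apply: epi_eq0 ee _; rewrite -pv.
  have ruv : r \c (u \c v) = 0 by rewrite compA -ap -compA pv compA at0 comp0l.
  case: (se_lift ur ruv) => w; rewrite -compA => /(se_mono uq) <-.
  by rewrite compA (se_0 ip) comp0l.
- by apply: (@epi_compl _ _ _ _ _ _ r); rewrite br; apply: se_epi uq.
move=> T t bt; case: (epi_cover t (se_epi ur)) => T' [e [v [ee rv]]].
have qv : q \c v = 0 by rewrite -br -compA rv compA bt comp0l.
case: (se_lift uq qv) => w uw.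
have am : mono a.
  apply: mono0 => T1 t1 at0.
  case: (epi_cover t1 (se_epi ip)) => T2 [e1 [v1 [ee1 pv1]]].
  apply: epi_eq0 ee1 _; rewrite -pv1.
  have ruv : r \c (u \c v1) = 0 by rewrite compA -ap -compA pv1 compA at0 comp0l.
  case: (se_lift ur ruv) => w1; rewrite -compA => /(se_mono uq) <-.
  by rewrite compA (se_0 ip) comp0l.
case: (mono_se am) => Q [c ac]; apply: (se_lift ac); apply: epi_eq0 ee _.
by rewrite -compA -rv -uw (compA r) -ap !compA (se_0 ac) !comp0l.
Qed.

(** The dual of [se_comp]. *)
Lemma se_comp' A B C1 D E' (i : hom A B) (p : hom B C1) (j : hom D C1)
    (q : hom C1 E') :
  short_exact i p -> short_exact j q ->
  exists F (k : hom F B) (h : hom A F) (r : hom F D),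
    [/\ short_exact k (q \c p), short_exact h r, k \c h = i & p \c k = j \c r].
Proof.
move=> ip jq; have qpe := epi_comp (se_epi jq) (se_epi ip).
case: (epi_se qpe) => F [k kqp].
have qpi : (q \c p) \c i = 0 by rewrite (postE _ (se_0 ip)) comp0r.
case: (se_lift kqp qpi) => h kh.
have qpk : q \c (p \c k) = 0 by rewrite compA (se_0 kqp).
case: (se_lift jq qpk) => r jr; exists F, k, h, r; split=> //.
apply: seI.
- by apply: mono_eq0 (se_mono jq) _; rewrite compA jr -compA kh (se_0 ip).
- by apply: (@mono_compr _ _ _ _ _ k); rewrite kh; apply: se_mono ip.
- apply: epi0 => T t tr; case: (epi_cover j (se_epi ip)) => T' [e [u [ee pu]]].
  have qpu : (q \c p) \c u = 0 by rewrite -compA pu compA (se_0 jq) comp0l.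
  case: (se_lift kqp qpu) => w kw; apply: epi_eq0 ee _.
  suff -> : e = r \c w by rewrite compA tr comp0l.
  by apply: (se_mono jq); rewrite compA jr -pu -kw compA.
move=> T t rt; have pkt : p \c (k \c t) = 0 by rewrite compA -jr -compA rt comp0r.
case: (se_lift ip pkt) => u iu; exists u; apply: (se_mono kqp).
by rewrite compA kh.
Qed.

(** The last hypothesis says that [M] contains the intersection of [J] and [M1]
    in [J1], so that [J / M] embeds into [J1 / M1]. *)
Lemma coker_mono M J N M1 J1 N1 (i : hom M J) (p : hom J N) (i1 : hom M1 J1)
    (p1 : hom J1 N1) (b : hom J J1) (n : hom N N1) :
  short_exact i p -> short_exact i1 p1 -> n \c p = p1 \c b ->
  (forall T (u : hom T J) (v : hom T M1), b \c u = i1 \c v ->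
    exists w, i \c w = u) -> mono n.
Proof.
move=> ip ip1 E U; apply: mono0 => T t nt.
case: (epi_cover t (se_epi ip)) => T' [e [u [ee pu]]]; apply: epi_eq0 ee _.
rewrite -pu; have p1bu : p1 \c (b \c u) = 0.
  by rewrite compA -E -compA pu compA nt comp0l.
case: (se_lift ip1 p1bu) => v /esym/U [w <-].
by rewrite compA (se_0 ip) comp0l.
Qed.

Lemma se_zero_l A X B (i : hom A X) (p : hom X B) :
  short_exact i p -> is_zero A -> iso p.
Proof.
move=> ip A0; apply: mono_epi_iso (se_epi ip); apply: mono0 => T t pt.
by case: (se_lift ip pt) => u <-; rewrite (zero_src i A0) comp0l.
Qed.

Lemma se_zero_r A X B (i : hom A X) (p : hom X B) :
  short_exact i p -> is_zero B -> iso i.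
Proof.
move=> ip B0; apply: mono_epi_iso (se_mono ip) _; apply: epi0 => T t ti.
by case: (se_desc ip ti) => u <-; rewrite (zero_tgt p B0) comp0r.
Qed.

Lemma se_idl X Z : is_zero Z -> short_exact (0 : hom Z X) (idm X).
Proof.
move=> Z0; apply: seI; rewrite ?comp0r //; first exact: zero_mono.
  by apply: iso_epi (iso_id X).
by move=> T t; rewrite comp1m => ->; exists 0; rewrite comp0r.
Qed.

Lemma se_idr X Z : is_zero Z -> short_exact (idm X) (0 : hom X Z).
Proof.
move=> Z0; apply: seI; rewrite ?comp0l //; first exact: iso_mono (iso_id X).
  by apply: epi0 => T t _; apply: zero_src.
by move=> T t _; exists t; rewrite comp1m.
Qed.

Lemma iso_se X Y (f : hom X Y) Z : iso f -> is_zero Z ->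
  short_exact f (0 : hom Y Z).
Proof.
move=> fi Z0; apply: seI; rewrite ?comp0l //; first exact: iso_mono.
  by apply: epi0 => T t _; apply: zero_src.
by case: fi => g [_ fg] T t _; exists (g \c t); rewrite compA fg comp1m.
Qed.

Lemma se_transport A X Y S (i : hom A X) (p : hom X S) (f : hom X Y)
    (g : hom Y X) : short_exact i p -> g \c f = idm X -> f \c g = idm Y ->
  short_exact (f \c i) (p \c g).
Proof.
move=> ip gf fg; have fi : iso f by exists g.
apply: seI.
- by rewrite compA (postE _ gf) compm1 (se_0 ip).
- by apply: mono_comp (iso_mono fi) (se_mono ip).
- by apply: epi_comp (se_epi ip) (iso_epi _); exists f.
move=> T t; rewrite -compA => /(se_lift ip) [u iu]; exists u.
by rewrite -compA iu compA fg comp1m.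
Qed.

Lemma biproduct_se X Y S (i1 : hom X S) (i2 : hom Y S) (p1 : hom S X)
    (p2 : hom S Y) : is_biproduct i1 i2 p1 p2 -> short_exact i1 p2.
Proof.
case=> E11 E22 E12 E21 E; apply: seI => //.
- by apply: (@mono_compr _ _ _ _ _ p1); rewrite E11; apply: iso_mono (iso_id X).
- by apply: (@epi_compl _ _ _ _ _ _ i2); rewrite E22; apply: iso_epi (iso_id Y).
move=> T t p2t; exists (p1 \c t).
by rewrite -[t in RHS]comp1m -E compDl compA -(compA i2) p2t comp0r addr0.
Qed.

Lemma inj_factor J X Y (r : hom X Y) (f : hom X J) : injective_obj J ->
  (forall T (t : hom T X), r \c t = 0 -> f \c t = 0) ->
  exists g : hom Y J, g \c r = f.
Proof.
move=> Jinj U; case: (image r) => A [m [e [mm ee mer]]].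
case: (epi_se ee) => B [k ke].
have fk : f \c k = 0 by apply: U; rewrite -mer (postE _ (se_0 ke)) comp0r.
case: (se_desc ke fk) => f' f'e; case: (Jinj _ _ m f' mm) => g gm.
by exists g; rewrite -mer compA gm.
Qed.

Lemma inj_biproduct X Y S (i1 : hom X S) (i2 : hom Y S) (p1 : hom S X)
    (p2 : hom S Y) : is_biproduct i1 i2 p1 p2 ->
  injective_obj X -> injective_obj Y -> injective_obj S.
Proof.
case=> E11 E22 E12 E21 E Xi Yi A B a f am.
case: (Xi _ _ a (p1 \c f) am) => g1 g1a; case: (Yi _ _ a (p2 \c f) am) => g2 g2a.
exists (i1 \c g1 + i2 \c g2).
by rewrite compDl -!compA g1a g2a !compA -compDl E comp1m.
Qed.

End Abelian.

(** * Unions in locally artinian categories *)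

Lemma dep_choice (T : nat -> Type) (P : forall n, T n -> Prop) :
  (forall n, exists t, P n t) -> exists f : forall n, T n, forall n, P n (f n).
Proof. by move=> H; exists (fun n => sval (cid (H n))) => n; apply: svalP. Qed.

Lemma dep_rec (T : nat -> Type) (R : forall n, T n -> T n.+1 -> Prop) (t0 : T 0) :
  (forall n t, exists t', R n t t') ->
  exists f : forall n, T n, f 0 = t0 /\ forall n, R n (f n) (f n.+1).
Proof.
move=> H; pose f := fix f n := match n return T n with
  | 0 => t0 | n'.+1 => sval (cid (H n' (f n'))) end.
by exists f; split=> // n /=; apply: svalP.
Qed.

Section Colimits.
Context {K : fieldType} {C : linCat K}.
Implicit Types X Y Z M N T : C.

Lemma hom_choice (B : nat -> C) (P : forall n Z, hom (B n) Z -> Prop) :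
  (forall n, exists Z (p : hom (B n) Z), P n Z p) ->
  exists (D : nat -> C) (p : forall n, hom (B n) (D n)), forall n, P n (D n) (p n).
Proof.
move=> H.
have [n|f fP] := @dep_choice (fun n => {Z : C & hom (B n) Z})
  (fun n s => P n (projT1 s) (projT2 s)).
  by case: (H n) => Z [p Pp]; exists (existT _ Z p).
by exists (fun n => projT1 (f n)), (fun n => projT2 (f n)).
Qed.

Section Chain.
Variables (A : nat -> C) (a : forall n, hom (A n) (A n.+1)).
Variables (X : C) (x : forall n, hom (A n) X).
Hypothesis ax : is_colimit a x.

Lemma colim_ext T (u v : hom X T) : (forall n, u \c x n = v \c x n) -> u = v.
Proof.
case: ax => xa U E.
have [|w [_ w1]] := U T (fun n => v \c x n).
  by move=> n; rewrite (postE _ (xa n)).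
by rewrite -(w1 u E) -(w1 v).
Qed.

Lemma colim_desc T (t : forall n, hom (A n) T) :
  (forall n, t n.+1 \c a n = t n) -> exists u, forall n, u \c x n = t n.
Proof. by case: ax => _ U /U [u [ut _]]; exists u. Qed.

Lemma colim_shift : is_colimit (fun n => a n.+1) (fun n => x n.+1).
Proof.
case: (ax) => xa U; split=> // T t ta.
have [|u ut] := @colim_desc T
    (fun n => match n with 0 => t 0 \c a 0 | n'.+1 => t n' end).
  by case.
exists u; split=> [n|u' u't]; first exact: (ut n.+1).
apply: colim_ext => n; rewrite ut; case: n => [|n]; last by rewrite u't.
by rewrite -(xa 0) compA u't.
Qed.

Lemma colim_iso Y (u : hom X Y) : iso u -> is_colimit a (fun n => u \c x n).
Proof.
case=> v [vu uv]; case: (ax) => xa U; split=> [n|T t ta].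
  by rewrite (postE _ (xa n)).
case: (U T t ta) => w [wt w1]; exists (w \c v); split=> [n|w' w't].
  by rewrite !compA (postE _ vu) compm1.
by rewrite (w1 (w' \c u)) ?(postE _ uv) ?compm1 // => n; rewrite -compA w't.
Qed.

Lemma colim_up n m T (g : hom T (A n)) : (n <= m)%N ->
  exists g' : hom T (A m), x m \c g' = x n \c g.
Proof.
move=> /subnKC <-; elim: (m - n)%N => [|k [g' E]].
  by rewrite addn0; exists g.
rewrite addnS; exists (a (n + k)%N \c g').
by case: ax => xa _; rewrite compA xa.
Qed.

End Chain.

Lemma colim_const X : is_colimit (fun _ => idm X) (fun _ : nat => idm X).
Proof.
split=> [n|T t tE]; first by rewrite comp1m.
exists (t 0); split=> [n|u ut]; last by rewrite -(ut 0) compm1.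
by rewrite compm1; elim: n => // n ->; rewrite -(tE n) compm1.
Qed.

End Colimits.

Section LocallyArtinian.
Context {K : fieldType} {C : linCat K} (HLA : locally_artinian C).
Implicit Types X Y Z M N T : C.
Let HA : abelian C := LA_abelian HLA.

Lemma LA_se (A B D : nat -> C) (a : forall n, hom (A n) (A n.+1))
    (b : forall n, hom (B n) (B n.+1)) (d : forall n, hom (D n) (D n.+1))
    (f : forall n, hom (A n) (B n)) (g : forall n, hom (B n) (D n))
    X Y (x : forall n, hom (A n) X) (y : forall n, hom (B n) Y) :
  (forall n, f n.+1 \c a n = b n \c f n) ->
  (forall n, g n.+1 \c b n = d n \c g n) ->
  (forall n, short_exact (f n) (g n)) ->
  is_colimit a x -> is_colimit b y ->
  exists Z (z : forall n, hom (D n) Z) (F : hom X Y) (G : hom Y Z),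
    [/\ is_colimit d z, forall n, F \c x n = y n \c f n,
        forall n, G \c y n = z n \c g n & short_exact F G].
Proof.
move=> fa gb fg ax by_; case: (LA1 HLA d) => Z [z dz].
have [|F FE] := @colim_desc _ _ _ _ _ _ ax Y (fun n => y n \c f n).
  by case: by_ => yb _ n; rewrite -compA fa compA yb.
have [|G GE] := @colim_desc _ _ _ _ _ _ by_ Z (fun n => z n \c g n).
  by case: dz => zd _ n; rewrite -compA gb compA zd.
exists Z, z, F, G; split=> //. exact: (LA2 HLA fa gb fg ax by_ dz).
Qed.

Lemma chain_coker (A B : nat -> C) (a : forall n, hom (A n) (A n.+1))
    (b : forall n, hom (B n) (B n.+1)) (f : forall n, hom (A n) (B n)) :
  (forall n, f n.+1 \c a n = b n \c f n) -> (forall n, mono (f n)) ->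
  exists (D : nat -> C) (d : forall n, hom (D n) (D n.+1))
    (g : forall n, hom (B n) (D n)),
    (forall n, g n.+1 \c b n = d n \c g n) /\
    (forall n, short_exact (f n) (g n)).
Proof.
move=> fa fm; have [n|D [g fg]] := @hom_choice _ _ B (fun n Z p => short_exact (f n) p).
  exact: mono_se.
have [n|d dE] := @dep_choice (fun n => hom (D n) (D n.+1))
    (fun n d => g n.+1 \c b n = d \c g n); last by exists D, d, g.
have E : g n.+1 \c b n \c f n = 0 by rewrite -compA -fa compA (se_0 (fg _)) comp0l.
by case: (se_desc (fg n) E) => u uE; exists u.
Qed.

Lemma LA_mono (A B : nat -> C) (a : forall n, hom (A n) (A n.+1))
    (b : forall n, hom (B n) (B n.+1)) (f : forall n, hom (A n) (B n))
    X Y (x : forall n, hom (A n) X) (y : forall n, hom (B n) Y) (F : hom X Y) :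
  (forall n, f n.+1 \c a n = b n \c f n) -> (forall n, mono (f n)) ->
  is_colimit a x -> is_colimit b y -> (forall n, F \c x n = y n \c f n) -> mono F.
Proof.
move=> fa fm ax by_ FE; case: (chain_coker fa fm) => D [d [g [gb fg]]].
case: (LA_se fa gb fg ax by_) => Z [z [F' [G [_ F'E _ FG]]]].
suff -> : F = F' by apply: se_mono FG.
by apply: (colim_ext ax) => n; rewrite FE F'E.
Qed.

(** By exactness, the colimit of an increasing sequence of subobjects of [X] is
    again a subobject of [X]; it is [X] itself when the sequence covers [X]. *)
Lemma union_colimit (A : nat -> C) (a : forall n, hom (A n) (A n.+1)) X
    (x : forall n, hom (A n) X) :
  (forall n, x n.+1 \c a n = x n) -> (forall n, mono (x n)) ->
  (forall T (t : hom X T), (forall n, t \c x n = 0) -> t = 0) ->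
  is_colimit a x.
Proof.
move=> xa xm xe; case: (LA1 HLA a) => P [y ay].
case: (colim_desc ay xa) => u uy.
have um : mono u.
  apply: (LA_mono _ xm ay (colim_const X)) => n; first by rewrite comp1m.
  by rewrite uy comp1m.
have ui : iso u.
  apply: (mono_epi_iso HA um); apply: epi0 => T t tu; apply: xe => n.
  by rewrite -uy compA tu comp0l.
have -> : x = (fun n => u \c y n) by apply: functional_extensionality_dep => n.
exact: colim_iso.
Qed.

Lemma colim_mono0 (A : nat -> C) (a : forall n, hom (A n) (A n.+1)) X
    (x : forall n, hom (A n) X) :
  (forall n, mono (a n)) -> is_colimit a x -> mono (x 0).
Proof.
move=> am ax; pose f := fix f n : hom (A 0) (A n) :=
  match n with 0 => idm (A 0) | n'.+1 => a n' \c f n' end.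
have fm n : mono (f n).
  by elim: n => [|n IH] /=; [apply: iso_mono (iso_id _) | apply: mono_comp].
apply: (LA_mono (f := f) _ fm (colim_const (A 0)) ax) => n; first by rewrite compm1.
rewrite compm1; elim: n => [|n ->] /=; first by rewrite compm1.
by case: ax => xa _; rewrite compA xa.
Qed.

Lemma colim_mono (A : nat -> C) (a : forall n, hom (A n) (A n.+1)) X
    (x : forall n, hom (A n) X) n :
  (forall n, mono (a n)) -> is_colimit a x -> mono (x n).
Proof.
elim: n A a x => [|n IH] A a x am ax; first exact: colim_mono0 ax.
by apply: (IH _ _ (fun n => x n.+1)) (colim_shift ax).
Qed.

(** Intersection distributes over unions: the part of [X] that [f] sends into
    one of the [A n] covers [X]. The image of [X] in [M / A n] is [X] modulo the
    part sent into [A n]; these images form a chain whose colimit embeds into the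
    colimit of the [M / A n], which is zero. *)
Lemma pull_union (A : nat -> C) (a : forall n, hom (A n) (A n.+1)) M
    (x : forall n, hom (A n) M) X T (f : hom X M) (t : hom X T) :
  is_colimit a x ->
  (forall n Y (k : hom Y X) (u : hom Y (A n)), f \c k = x n \c u -> t \c k = 0) ->
  t = 0.
Proof.
move=> ax H; have xa := ax.1.
have [n|Q [c cP]] := @hom_choice _ _ (fun _ => M) (fun n Z p => is_cokernel (x n) p).
  exact: ab_coker.
have [n|q qE] := @dep_choice (fun n => hom (Q n) (Q n.+1))
    (fun n q => c n.+1 = q \c c n).
  case: (cP n) => _ U; have [|u [uE _]] := U _ (c n.+1).
    by rewrite -xa (compA (c _)) (cP n.+1).1 comp0l.
  by exists u.
case: (LA1 HLA q) => R [r qr].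
have rc n : r n \c c n = r 0 \c c 0.
  by elim: n => // n <-; rewrite qE compA qr.1.
have R0 : is_zero R.
  apply/zeroP/(colim_ext qr) => n; rewrite comp0l comp1m.
  apply: epi_eq0 (cokernel_epi (cP n)) _; rewrite rc.
  by apply: (colim_ext ax) => m; rewrite comp0l -(rc m) -compA (cP m).1 comp0r.
have [n|D [e eP]] := @hom_choice _ _ (fun _ => X)
    (fun n Z e => epi e /\ exists m : hom Z (Q n), mono m /\ m \c e = c n \c f).
  by case: (image HA (c n \c f)) => Z [m [e [mm ee E]]]; exists Z, e; split=> //; exists m.
have [n|m mP] := @dep_choice (fun n => hom (D n) (Q n))
    (fun n m => mono m /\ m \c e n = c n \c f).
  by case: (eP n).
have kill n Y (k : hom Y X) : c n \c f \c k = 0 -> t \c k = 0.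
  move=> E; case: (image HA (x n)) => Z [j [l [jm le jl]]].
  have jc : short_exact j (c n).
    apply: (coker_se HA jm); case: (cP n) => c0 U; apply: cokernelI.
    - by apply: epi_eq0 le _; rewrite -compA jl.
    - exact: cokernel_epi (cP n).
    move=> W w wj; have [|v [vE _]] := U _ w; last by exists v.
    by rewrite -jl compA wj comp0l.
  case: (se_lift jc (t := f \c k)) => [|s js]; first by rewrite compA.
  case: (epi_cover HA s le) => Y' [e' [u [ee' lu]]]; apply: epi_eq0 ee' _.
  by rewrite -compA; apply: (H n _ _ u); rewrite compA -js -jl -!compA lu.
have [n|d dE] := @dep_choice (fun n => hom (D n) (D n.+1))
    (fun n d => d \c e n = e n.+1).
  case: (epi_se HA (eP n).1) => Z [k ke].
  case: (se_desc ke (t := e n.+1)) => [|u uE]; last by exists u.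
  apply: mono_eq0 (mP n.+1).1 _; rewrite compA (mP _).2 qE -!compA (compA (c n)).
  by rewrite -(mP n).2 -compA (se_0 ke) !comp0r.
have [n|s sE] := @dep_choice (fun n => hom (D n) T) (fun n s => s \c e n = t).
  case: (epi_se HA (eP n).1) => Z [k ke].
  case: (se_desc ke (t := t)) => [|u uE]; last by exists u.
  by apply: (kill n); rewrite -(mP n).2 -compA (se_0 ke) comp0r.
case: (LA1 HLA d) => E [y dy].
have md n : m n.+1 \c d n = q n \c m n.
  apply: (eP n).1; rewrite -compA dE (mP _).2 qE -[RHS]compA (mP _).2.
  by rewrite !compA.
have [|F FE] := colim_desc dy (t := fun n => r n \c m n).
  by move=> n; rewrite -compA md compA qr.1.
have Fm : mono F by apply: (LA_mono md _ dy qr FE) => n; exact: (mP n).1.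
have E0 := sub_zero Fm R0.
have [|G GE] := colim_desc dy (t := s).
  by move=> n; apply: (eP n).1; rewrite -compA dE !sE.
by rewrite -(sE 0) -GE (zero_tgt (y 0) E0) comp0r comp0l.
Qed.

End LocallyArtinian.

(** * Simple objects and objects of finite length *)

Section FiniteLength.
Context {K : fieldType} {C : linCat K} (HLA : locally_artinian C).
Implicit Types A B F X Y Z M N S T : C.
Let HA : abelian C := LA_abelian HLA.

Lemma simple_mono S Y (f : hom S Y) : simple S -> f <> 0 -> mono f.
Proof.
case=> _ Ss f0; case: (ab_ker HA f) => A [k kk]; apply: mono0 => T t ft.
have km := kernel_mono kk; case: kk => fk U.
have [u [<- _]] := U _ t ft; case: (Ss _ k km) => [A0|ki].
  by rewrite (zero_tgt u A0) comp0r.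
by case: f0; apply: epi_eq0 (iso_epi ki) fk.
Qed.

Lemma simple_epi S Y (f : hom Y S) : simple S -> f <> 0 -> epi f.
Proof.
case=> _ Ss f0; case: (image HA f) => A [m [e [mm ee E]]].
case: (Ss _ m mm) => [A0|mi].
  by case: f0; rewrite -E (zero_src m A0) comp0l.
by rewrite -E; apply: epi_comp ee; apply: iso_epi.
Qed.

Lemma schur S S' (f : hom S S') : simple S -> simple S' -> f <> 0 -> iso f.
Proof.
by move=> Ss Ss' f0; apply: (mono_epi_iso HA); [apply: simple_mono | apply: simple_epi].
Qed.

Lemma fl_iso X Y (f : hom X Y) : iso f -> finite_length X -> finite_length Y.
Proof.
move=> fi X0; case: X0 Y f fi => [{}X X0|A {}X S i p Afl Ss ip] Y f fi.
  by apply: FiniteLength0; apply: epi_zero (iso_epi fi) _; apply: zero_src.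
case: (fi) => g [gf fg]; apply: (@FiniteLengthS _ _ A Y S (f \c i) (p \c g)) => //.
exact: se_transport.
Qed.

Lemma fl_sub X Y (f : hom X Y) : mono f -> finite_length Y -> finite_length X.
Proof.
move=> fm Yfl; elim: Yfl X f fm => [{}Y Y0|A {}Y S i p Afl IH Ss ip] X f fm.
  by apply: FiniteLength0; apply: sub_zero fm Y0.
case: (pselect (p \c f = 0)) => [pf|pf].
  case: (se_lift ip pf) => u iu; apply: (IH X u).
  by apply: (@mono_compr _ _ _ _ _ i); rewrite iu.
case: (epi_se HA (simple_epi Ss pf)) => B [k kpf].
apply: (FiniteLengthS _ Ss kpf).
have pfk : p \c (f \c k) = 0 by rewrite compA (se_0 kpf).
case: (se_lift ip pfk) => u iu; apply: (IH B u).
apply: (@mono_compr _ _ _ _ _ i); rewrite iu.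
by apply: mono_comp fm (se_mono kpf).
Qed.

Lemma fl_quot X Y (f : hom X Y) : epi f -> finite_length X -> finite_length Y.
Proof.
move=> fe Xfl; elim: Xfl Y f fe => [{}X X0|A {}X S i p Afl IH Ss ip] Y f fe.
  by apply: FiniteLength0; apply: epi_zero fe _; apply: zero_src.
case: (image HA (f \c i)) => A1 [m [e [mm ee E]]].
have A1fl := IH _ e ee; case: (mono_se HA mm) => Q [q mq].
have qfi : q \c f \c i = 0 by rewrite -compA -E compA (se_0 mq) comp0l.
case: (se_desc ip qfi) => s sp.
have se : epi s.
  by apply: (@epi_compl _ _ _ _ _ _ p); rewrite sp; apply: epi_comp (se_epi mq) fe.
case: (pselect (s = 0)) => [s0|s0].
  apply: fl_iso A1fl; apply: (se_zero_r HA mq); exact: epi_zero se s0.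
apply: (FiniteLengthS A1fl _ mq).
have si : iso s by apply: (mono_epi_iso HA) se; apply: simple_mono s0.
have sS : iso s by [].
case: si => s' [s's ss']; case: Ss => Sn Ss; split.
  move=> Q0; apply: Sn; exact: sub_zero (iso_mono sS) Q0.
move=> B b bm; have s'm : mono s' by apply: iso_mono; exists s.
case: (Ss _ (s' \c b) (mono_comp s'm bm)) => [|[g [g1 g2]]]; [by left|right].
exists (g \c s'); split; first by rewrite -compA.
rewrite compA.
have -> : b = s \c (s' \c b) by rewrite compA ss' comp1m.
by rewrite -(compA s) g2 compm1.
Qed.

Lemma fl_test X T (t : hom X T) :
  (forall F (k : hom F X), finite_length F -> mono k -> t \c k = 0) -> t = 0.
Proof.
move=> H; case: (LA3 HLA X) => G Gfl; apply: (colim_ext (fil_union G)) => n.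
by rewrite comp0l H //; apply: fil_in_mono.
Qed.

(** Induction on the length of [X]: when [f] sends the kernel [B] of [X -> S]
    into some term, [pull_union] provides a further element of [X], not killed in
    [S], that also goes to some term; it generates [X] together with [B]. *)
Lemma fl_compact (A : nat -> C) (a : forall n, hom (A n) (A n.+1)) M
    (x : forall n, hom (A n) M) X (f : hom X M) :
  (forall n, mono (a n)) -> is_colimit a x -> finite_length X ->
  exists n (g : hom X (A n)), x n \c g = f.
Proof.
move=> am ax Xfl; elim: Xfl f => [{}X X0|B {}X S i p Bfl IH Ss ip] f.
  by exists 0, 0; rewrite comp0r (zero_src f X0).
case: (IH (f \c i)) => n [g E].
have pn0 : p <> 0.
  by move=> p0; case: Ss => Sn _; apply: Sn; apply: epi_zero (se_epi ip) p0.
have [m [Y [k [u [fk pk]]]]] : exists m Y (k : hom Y X) (u : hom Y (A m)),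
    f \c k = x m \c u /\ p \c k <> 0.
  apply: contrapT => N; apply: pn0; apply: (pull_union HLA (f := f) ax).
  move=> m Y k u fk; apply: contrapT => pk; apply: N.
  by exists m, Y, k, u.
have [g' E'] := colim_up ax g (leq_maxl n m).
have [u' F'] := colim_up ax u (leq_maxr n m).
exists (maxn n m); have xm := colim_mono (n := maxn n m) HLA am ax.
case: (mono_se HA xm) => Q [c xc].
have cf : c \c f = 0.
  have cfi : c \c f \c i = 0 by rewrite -compA -E -E' compA (se_0 xc) comp0l.
  case: (se_desc ip cfi) => s sp; rewrite -sp.
  suff -> : s = 0 by rewrite comp0l.
  apply: epi_eq0 (simple_epi Ss pk) _.
  by rewrite compA sp -compA fk -F' compA (se_0 xc) comp0l.
by case: (se_lift xc cf) => v vE; exists v.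
Qed.

(** Length as an index, for inductions in which a proper subobject replaces the
    object. *)
Inductive has_length : nat -> C -> Prop :=
| HasLength0 X : is_zero X -> has_length 0 X
| HasLengthS n A X S (i : hom A X) (p : hom X S) :
    has_length n A -> simple S -> short_exact i p -> has_length n.+1 X.

Lemma fl_length X : finite_length X -> exists n, has_length n X.
Proof.
elim=> [{}X X0|A {}X S i p _ [n An] Ss ip]; first by exists 0; left.
by exists n.+1; apply: HasLengthS An Ss ip.
Qed.

Lemma length_iso n X Y (f : hom X Y) : iso f -> has_length n X -> has_length n Y.
Proof.
move=> fi X0; case: X0 Y f fi => [{}X X0|{}n A {}X S i p Afl Ss ip] Y f fi.
  by left; apply: epi_zero (iso_epi fi) _; apply: zero_src.
case: (fi) => g [gf fg]; apply: (@HasLengthS _ A Y S (f \c i) (p \c g)) => //.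
exact: se_transport.
Qed.

Lemma length_sub n X Y (f : hom X Y) : mono f -> has_length n Y ->
  iso f \/ exists2 m, (m < n)%N & has_length m X.
Proof.
move=> fm Yn; elim: Yn X f fm => [{}Y Y0|{}n A {}Y S i p An IH Ss ip] X f fm.
  by left; apply: (mono_epi_iso HA fm); apply: epi0 => T t _; apply: zero_src.
case: (pselect (p \c f = 0)) => [pf|pf].
  case: (se_lift ip pf) => u iu; right.
  have um : mono u by apply: (@mono_compr _ _ _ _ _ i); rewrite iu.
  case: (IH X u um) => [[v [vu uv]]|[m mn Xm]].
    by exists n => //; apply: (length_iso (f := v) _ An); exists u.
  by exists m => //; apply: ltnW.
have pfe := simple_epi Ss pf; case: (epi_se HA pfe) => B [k kpf].
have pfk : p \c (f \c k) = 0 by rewrite compA (se_0 kpf).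
case: (se_lift ip pfk) => u iu.
have um : mono u.
  by apply: (@mono_compr _ _ _ _ _ i); rewrite iu; apply: mono_comp fm (se_mono kpf).
case: (IH B u um) => [ui|[m mn Bm]]; last first.
  by right; exists m.+1 => //; apply: HasLengthS Bm Ss kpf.
left; apply: (mono_epi_iso HA fm); apply: epi0 => T t tf.
have ti : t \c i = 0.
  by apply: epi_eq0 (iso_epi ui) _; rewrite -compA iu compA tf comp0l.
case: (se_desc ip ti) => s sp; rewrite -sp.
suff -> : s = 0 by rewrite comp0l.
by apply: epi_eq0 pfe _; rewrite compA sp.
Qed.

End FiniteLength.

(** * Torsion classes *)

Definition below (k : nat) : pred nat := fun m => (m < k)%N.

Section Torsion.
Context {K : fieldType} {C : linCat K} (D : LAplus C).
Implicit Types A B F X Y Z M N T : C.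
Let HLA : locally_artinian C := LAp_LA D.
Let HA : abelian C := LA_abelian HLA.
Notation L := (simp D).
Notation I := (env D).

(** The composition factors of [X] all have index in [S]: since [Hom(-, I m)]
    is exact and detects exactly the factor [L m], this can be said without
    filtrations, and closure under subobjects, quotients, extensions and
    colimits becomes immediate. *)
Definition tors (S : pred nat) X : Prop :=
  forall m, ~~ S m -> forall f : hom X (I m), f = 0.

Lemma env_inj m : injective_obj (I m).
Proof. by case: (envP D m). Qed.

Lemma env_in_mono m : mono (env_in D m).
Proof. by case: (envP D m). Qed.

Lemma simple_semisimple (S : C) : simple S -> semisimple S.
Proof.
move=> Ss; exists unit, (fun _ => S), (fun _ => idm S); split=> // T t.
by exists (t tt); split=> [[]|u ut]; [rewrite compm1 | rewrite -(ut tt) compm1].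
Qed.

(** A simple subobject of [I m] lies in its socle, which is also that of [L m]. *)
Lemma simp_env j m (f : hom (L j) (I m)) : f <> 0 -> j = m.
Proof.
move=> f0; have fm := simple_mono HLA (simp_simple D j) f0.
case: (envP D m) => _ _ [S [s [_ [_ _ smax]]]].
have [h E] := smax _ f fm (simple_semisimple (simp_simple D j)).
apply: (simp_neq (l := D)); exists (s \c h).
apply: (schur HLA (simp_simple D j) (simp_simple D m)) => sh.
by apply: f0; rewrite -E -compA sh comp0r.
Qed.

Lemma env_in_neq0 m : env_in D m <> 0.
Proof.
by move=> E; have [+ _] := simp_simple D m; apply; apply: mono_zero E; apply: env_in_mono.
Qed.

Lemma tors_sub S X Y (f : hom X Y) : mono f -> tors S Y -> tors S X.
Proof.
move=> fm YS m Sm g; case: (env_inj (m := m) g fm) => h <-.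
by rewrite (YS m Sm h) comp0l.
Qed.

Lemma tors_quot S X Y (f : hom X Y) : epi f -> tors S X -> tors S Y.
Proof. by move=> fe XS m Sm g; apply: epi_eq0 fe _; apply: XS. Qed.

Lemma tors_ext S X Y Z (i : hom X Y) (p : hom Y Z) : short_exact i p ->
  tors S X -> tors S Z -> tors S Y.
Proof.
move=> ip XS ZS m Sm g; case: (se_desc ip (XS m Sm (g \c i))) => u <-.
by rewrite (ZS m Sm u) comp0l.
Qed.

Lemma tors_colim S (A : nat -> C) (a : forall n, hom (A n) (A n.+1)) X
    (x : forall n, hom (A n) X) :
  is_colimit a x -> (forall n, tors S (A n)) -> tors S X.
Proof.
move=> ax AS m Sm g; apply: (colim_ext ax) => n.
by rewrite comp0l; apply: AS.
Qed.

Lemma tors_zero S X : is_zero X -> tors S X.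
Proof. by move=> X0 m _ f; apply: zero_src. Qed.

Lemma tors_mono (S S' : pred nat) X : (forall m, S m -> S' m) -> tors S X -> tors S' X.
Proof. by move=> SS' XS m S'm; apply: XS; apply: contra S'm; apply: SS'. Qed.

Lemma tors_simp (S : pred nat) j : S j -> tors S (L j).
Proof.
move=> Sj m Sm f; apply: contrapT => f0.
by move: Sm; rewrite -(simp_env f0) Sj.
Qed.

Lemma tors_simpP S X j (f : hom X (L j)) : tors S X -> f <> 0 -> S j.
Proof.
move=> XS f0; apply/negPn/negP => Sj; apply: f0.
by apply: mono_eq0 (@env_in_mono j) _; apply: XS.
Qed.

Lemma fl_hom0 S F Y (f : hom F Y) : finite_length F -> tors S F ->
  (forall j, S j -> forall g : hom (L j) Y, g = 0) -> f = 0.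
Proof.
move=> Ffl FS Y0; elim: Ffl FS f => [X X0|A X S' i p Afl IH Ss ip] FS f.
  exact: zero_src.
have AS : tors S A by apply: tors_sub FS; apply: se_mono ip.
case: (se_desc ip (IH AS (f \c i))) => u <-.
suff -> : u = 0 by rewrite comp0l.
have [j [h hi]] := simp_all D Ss.
have hp : h \c p <> 0.
  move=> E; have [] := Ss; case; apply: epi_zero (se_epi ip) _.
  exact: mono_eq0 (iso_mono hi) E.
have Sj := tors_simpP FS hp.
case: hi => g [gh _]; rewrite -[u]compm1 -gh compA (Y0 j Sj (u \c g)) comp0l //.
Qed.

(** A composition series of a subobject of finite length of [X] has its factors
    in [S], and a map to [Y] is killed on one factor after the other. *)
Lemma tors_hom0 S X Y (f : hom X Y) : tors S X ->
  (forall j, S j -> forall g : hom (L j) Y, g = 0) -> f = 0.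
Proof.
move=> XS Y0; apply: (fl_test HLA) => F k Ffl km.
exact: (fl_hom0 _ Ffl (tors_sub km XS) Y0).
Qed.

Lemma in_Cle_tors n X : in_Cle L n X -> tors (below n.+1) X.
Proof.
case=> G GQ; apply: (tors_colim (fil_union G)) => j.
have Qt Q : is_zero Q \/ (exists2 k, (k <= n)%N & isomorphic Q (L k)) ->
    tors (below n.+1) Q.
  case=> [Q0|[l ln [f fi]]]; first exact: tors_zero.
  by apply: tors_sub (iso_mono fi) _; apply: tors_simp; rewrite /below ltnS.
elim: j => [|j IH].
  case: (GQ 0) => Q [[f fi] QL].
  by apply: tors_sub (iso_mono fi) (Qt _ QL).
case: (GQ j.+1) => Q [QG QL]; have QS := Qt _ QL; case: QG => q qc.
apply: (tors_ext _ IH QS).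
apply: (coker_se HA) qc.
apply: (@mono_compr _ _ _ _ _ (fil_in G j.+1)).
have [E _] := fil_union G; rewrite E; exact: fil_in_mono.
Qed.

End Torsion.

(** * Filtrations of extensions, canonical subobjects *)

Section Canonical.
Context {K : fieldType} {C : linCat K} (D : LAplus C).
Implicit Types A B F X Y Z M N T : C.
Let HLA : locally_artinian C := LAp_LA D.
Let HA : abelian C := LA_abelian HLA.
Notation L := (simp D).
Notation I := (env D).

Lemma fil_step_mono M (G : filtration M) n : mono (fil_step G n).
Proof.
apply: (@mono_compr _ _ _ _ _ (fil_in G n.+1)); have [-> _] := fil_union G.
exact: fil_in_mono.
Qed.

Lemma preimage_filtration A B X (i : hom A B) (p : hom B X) (G : filtration X) :
  short_exact i p ->
  exists (H : filtration B) (h : forall n, hom A (H n))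
    (r : forall n, hom (H n) (G n)),
    [/\ forall n, short_exact (h n) (r n),
        forall n, fil_in H n \c h n = i,
        forall n, p \c fil_in H n = fil_in G n \c r n,
        forall n, r n.+1 \c fil_step H n = fil_step G n \c r n
      & forall n Q (q : hom (G n.+1) Q), is_cokernel (fil_step G n) q ->
          short_exact (fil_step H n) (q \c r n.+1)].
Proof.
move=> ip; have Gin n := (fil_union G).1 n.
have [n|Q [c cP]] := @hom_choice _ _ (fun _ => X)
  (fun n Q c => short_exact (fil_in G n) c).
  by apply: (mono_se HA); apply: fil_in_mono.
have [n|s sP] := @dep_choice
    (fun n => {F : C & (hom F B * hom A F * hom F (G n))%type})
    (fun n s => let: (k, h, r) := projT2 s in
      [/\ short_exact k (c n \c p), short_exact h r, k \c h = i
        & p \c k = fil_in G n \c r]).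
  by case: (se_comp' HA ip (cP n)) => F [k [h [r E]]]; exists (existT _ F (k, h, r)).
pose F n := projT1 (s n).
pose k n : hom (F n) B := (projT2 (s n)).1.1.
pose h n : hom A (F n) := (projT2 (s n)).1.2.
pose r n : hom (F n) (G n) := (projT2 (s n)).2.
have P n : [/\ short_exact (k n) (c n \c p), short_exact (h n) (r n),
    k n \c h n = i & p \c k n = fil_in G n \c r n].
  by have := sP n; rewrite /k /h /r /F; case: (s n) => Fn [[kn hn] rn].
move: F k h r P => {s sP} F k h r P.
have km n : mono (k n) by case: (P n) => /se_mono.
have cstep n : exists st : hom (F n) (F n.+1), k n.+1 \c st = k n.
  case: (P n) => _ _ _ pk; case: (P n.+1) => kc _ _ _.
  have E : c n.+1 \c p \c k n = 0.
    by rewrite -compA pk -Gin !compA (se_0 (cP _)) !comp0l.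
  by case: (se_lift kc E) => u uE; exists u.
have [st stE] := dep_choice cstep.
have rst n : r n.+1 \c st n = fil_step G n \c r n.
  case: (P n) => _ _ _ pk; case: (P n.+1) => _ _ _ pk1.
  by apply: (fil_in_mono (f := G) (n := n.+1)); rewrite !compA Gin -pk -pk1 -compA stE.
have un : is_colimit st k.
  apply: (union_colimit HLA stE km) => T t tk.
  have ti : t \c i = 0 by case: (P 0) => _ _ <- _; rewrite compA tk comp0l.
  case: (se_desc ip ti) => t' t'p; rewrite -t'p.
  suff -> : t' = 0 by rewrite comp0l.
  apply: (colim_ext (fil_union G)) => n; rewrite comp0l.
  case: (P n) => _ hr _ pk; apply: epi_eq0 (se_epi hr) _.
  by rewrite -compA -pk compA t'p tk.
exists (Filtration km un), h, r; split=> //= n; try by case: (P n).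
move=> Q' q qc; have Gq : short_exact (fil_step G n) q.
  by apply: (coker_se HA) qc; apply: fil_step_mono.
case: (P n) => kc hr kh pk; case: (P n.+1) => kc1 hr1 kh1 pk1.
apply: (seI HA).
- by rewrite -compA rst compA (se_0 Gq) comp0l.
- by apply: (@mono_compr _ _ _ _ _ (k n.+1)); rewrite stE.
- by apply: epi_comp (se_epi Gq) (se_epi hr1).
move=> T t; rewrite -compA => /(se_lift Gq) [u uE].
have ckt : c n \c p \c (k n.+1 \c t) = 0.
  by rewrite compA -(compA (c n)) pk1 -!compA -uE !compA -(compA (c n)) Gin
    (se_0 (cP n)) comp0l.
case: (se_lift kc ckt) => v vE; exists v; apply: (km n.+1).
by rewrite compA stE.
Qed.

(** A filtration of a quotient pulls back, and can be preceded by the kernel;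
    this lets canonical filtrations grow at the bottom, where no end of an
    infinite sequence is in the way. *)
Lemma in_Cle_prepend n A X B (i : hom A X) (p : hom X B) : short_exact i p ->
  is_zero A \/ (exists2 k, (k <= n)%N & isomorphic A (L k)) ->
  in_Cle L n B -> in_Cle L n X.
Proof.
move=> ip AL [G GQ]; case: (preimage_filtration G ip) => H [h [r [hr kh pk rst Hq]]].
pose fil m := match m with 0 => A | m'.+1 => H m' end.
pose fin m : hom (fil m) X := match m with 0 => i | m'.+1 => fil_in H m' end.
pose fst m : hom (fil m) (fil m.+1) :=
  match m with 0 => h 0 | m'.+1 => fil_step H m' end.
have fm m : mono (fin m).
  by case: m => [|m] /=; [apply: se_mono ip | apply: fil_in_mono].
have fu : is_colimit fst fin.
  apply: (union_colimit HLA _ fm) => [[|m] /=|T t tf]; first exact: kh.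
    by case: (fil_union H).
  by apply: (colim_ext (fil_union H)) => m; rewrite comp0l (tf m.+1).
exists (Filtration fm fu) => -[|[|m]] /=.
- by exists A; split=> //; exists (idm A); apply: iso_id.
- case: (GQ 0) => Q [[g gi] QL]; exists Q; split=> //; exists (g \c r 0).
  by apply: iso_cokernel gi; case: (hr 0).
case: (GQ m.+1) => Q [[q qc] QL]; exists Q; split=> //; exists (q \c r m.+1).
by case: (Hq m Q q qc).
Qed.

Lemma in_Cle_zero n X : is_zero X -> in_Cle L n X.
Proof.
move=> X0.
have Xm (m : nat) : mono (idm X) by apply: iso_mono (iso_id X).
exists (Filtration Xm (colim_const X)) => -[|m] /=; exists X; split; try by left.
  by exists (idm X); apply: iso_id.
exists 0; apply: cokernelI; first exact: zero_tgt.
  by apply: epi0 => T t _; apply: zero_src.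
by move=> T t _; exists 0; rewrite comp0l; apply/esym/zero_src.
Qed.

Lemma fl_in_Cle_ext n A X B (i : hom A X) (p : hom X B) : finite_length A ->
  short_exact i p -> tors D (below n.+1) A -> in_Cle L n B -> in_Cle L n X.
Proof.
move=> Afl; elim: Afl X B i p => [{}A A0|A1 {}A S j q A1fl IH Ss jq] X B i p ip At Bn.
  by apply: in_Cle_prepend ip _ Bn; left.
have A1t : tors D (below n.+1) A1 := tors_sub (se_mono jq) At.
have ijm := mono_comp (se_mono ip) (se_mono jq).
case: (mono_se HA ijm) => W [w ijw].
case: (se_comp HA jq ip ijw) => a [b [ab _ _]].
apply: (IH _ _ _ _ ijw A1t); apply: in_Cle_prepend ab _ Bn; right.
case: (simp_all D Ss) => k [f fi]; exists k; last by exists f.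
have St : tors D (below n.+1) S := tors_quot (se_epi jq) At.
have f0 : f <> 0.
  by move=> f0; have [+ _] := Ss; apply; apply: mono_zero (iso_mono fi) f0.
by have := tors_simpP St f0; rewrite /below ltnS.
Qed.

Lemma fl_in_Cle n X : finite_length X -> tors D (below n.+1) X -> in_Cle L n X.
Proof.
move=> Xfl Xt; case: (ab_zero HA) => Z Z0.
exact: fl_in_Cle_ext Xfl (se_idr HA X Z0) Xt (in_Cle_zero n Z0).
Qed.

(** If [L j] occurred in the socle of the quotient, its preimage would contain
    an object of finite length that lies in [C(n)] but not in the largest
    subobject with this property. *)
Lemma canon_quot n A X Q (i : hom A X) (q : hom X Q) j (f : hom (L j) Q) :
  is_canon L n i -> short_exact i q -> (j <= n)%N -> f = 0.
Proof.
case=> im An imax iq jn; case: (pselect (f = 0)) => // f0.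
have fm := simple_mono HLA (simp_simple D j) f0.
case: (pullback HA q f) => P [a [b pb]].
case: (pullback_se HA iq pb) => k [kb ak].
have am := pullback_mono pb fm.
have Pt : tors D (below n.+1) P.
  apply: tors_ext kb (in_Cle_tors An) _.
  by apply: tors_simp; rewrite /below ltnS.
apply: epi_eq0 (se_epi kb) _; apply: (fl_test HLA) => F l Ffl lm.
have alm := mono_comp am lm.
have [h E] := imax _ _ alm (fl_in_Cle Ffl (tors_sub lm Pt)).
by case: pb => fb _; rewrite -fb -compA -E compA (se_0 iq) comp0l.
Qed.

(** This is all that is needed from the definition of [nabla n]: its quotient by
    [L n] has factors of index below [n], so it has no maps to [I m], [m >= n]. *)
Lemma nabla_simp n : exists l : hom (L n) (nabla D n),
  [/\ nabla_in D n \c l = env_in D n, mono (nabla_in D n)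
    & forall m (f : hom (nabla D n) (I m)), (n <= m)%N -> f \c l = 0 -> f = 0].
Proof.
case: (nablaP D n) => Q [q [W [w [r [qc wP pb]]]]]; case: (pb) => E U.
have iq := coker_se HA (@env_in_mono _ _ D n) qc.
have [|l [[vl rl] _]] := U _ (env_in D n) 0; first by rewrite (se_0 iq) comp0r.
have wm : mono w by case: (n) wP => [|n'] /= => [/zero_mono|[]].
exists l; split=> //; first exact: pullback_mono pb wm.
move=> m f nm fl0.
have [|g gr] := inj_factor HA (r := r) (f := f) (env_inj (m := m)).
  move=> T t rt.
  have qvt : q \c (nabla_in D n \c t) = 0 by rewrite compA E -compA rt comp0r.
  case: (se_lift iq qvt) => s sE; suff <- : l \c s = t by rewrite compA fl0 comp0l.
  by apply: (pullback_mono pb wm); rewrite compA vl sE.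
rewrite -gr; suff -> : g = 0 by rewrite comp0l.
case: (n) nm wP => [|n'] nm /= wP; first exact: zero_src.
case: wP => _ Wn _; by apply: (in_Cle_tors Wn); rewrite /below -leqNgt.
Qed.

Lemma nabla_tors n : tors D (below n.+1) (nabla D n).
Proof.
move=> m; rewrite /below -leqNgt => nm f; case: (nabla_simp n) => l [_ _ kill].
apply: kill (ltnW nm) _; case: (pselect (f \c l = 0)) => // /simp_env E.
by rewrite E ltnn in nm.
Qed.

End Canonical.

(** * Injective objects *)

Section Injective.
Context {K : fieldType} {C : linCat K} (D : LAplus C).
Implicit Types A B F X Y Z M N T J : C.
Let HLA : locally_artinian C := LAp_LA D.
Let HA : abelian C := LA_abelian HLA.
Notation L := (simp D).
Notation I := (env D).

Definition extends X M : Prop := forall A B (a : hom A B) (p : hom B X),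
  short_exact a p -> forall f : hom A M, exists g : hom B M, g \c a = f.

Lemma extends_iso X X' M (u : hom X X') : iso u -> extends X' M -> extends X M.
Proof.
move=> ui E A B a p ap; apply: (E _ _ a (u \c p)).
apply: (coker_se HA (se_mono ap)); apply: iso_cokernel ui; by case: ap.
Qed.

Lemma baer_fl S M X : finite_length X -> tors D S X ->
  (forall j, S j -> extends (L j) M) -> extends X M.
Proof.
move=> Xfl Xt ML; elim: Xfl Xt => [{}X X0|A' {}X S' i' p' _ IH Ss ip'] Xt A B a p ap f.
  case: (se_zero_r HA ap X0) => b [ba ab].
  by exists (f \c b); rewrite (postE _ ba) compm1.
case: (se_comp' HA ap ip') => F [k [h [r [kp hr kh pk]]]].
case: (IH (tors_sub (se_mono ip') Xt) _ _ h r hr f) => g gh.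
have [j [u ui]] := simp_all D Ss.
have St : tors D S S' := tors_quot (se_epi ip') Xt.
have Sj : S j.
  apply: tors_simpP St (_ : u <> 0) => u0; have [+ _] := Ss; apply.
  exact: mono_zero (iso_mono ui) u0.
case: (extends_iso ui (ML j Sj) kp g) => g' g'k.
by exists g'; rewrite -kh compA g'k.
Qed.

(** A relative form of Baer's criterion, for extending maps along
    monomorphisms whose cokernel has all its factors in [S]. The cokernel is
    exhausted by objects of finite length, and the map is extended step by
    step. *)
Lemma baer S M X : tors D S X -> (forall j, S j -> extends (L j) M) -> extends X M.
Proof.
move=> Xt ML A B a p ap f; case: (LA3 HLA X) => G Gfl.
have Gt n : tors D S (G n) by apply: tors_sub Xt; apply: fil_in_mono.
case: (preimage_filtration D G ap) => H [h [r [hr kh pk rst Hq]]].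
have [g0 g0h] := baer_fl (Gfl 0) (Gt 0) ML (hr 0) f.
have [n g|g [g00 gE]] := @dep_rec (fun n => hom (H n) M)
    (fun n g g' => g' \c fil_step H n = g) g0.
  case: (mono_se HA (fil_step_mono (G := G) (n := n))) => Q [q Gq].
  apply: (baer_fl _ _ ML (Hq n Q q Gq.2)).
  - exact: (fl_quot HLA (se_epi Gq) (Gfl n.+1)).
  - exact: tors_quot (se_epi Gq) (Gt n.+1).
case: (colim_desc (fil_union H) gE) => u uE; exists u.
by rewrite -(kh 0) compA uE g00.
Qed.

Lemma inj_crit M : (forall j, extends (L j) M) -> injective_obj M.
Proof.
move=> ML A B a f am; case: (mono_se HA am) => X [p ap].
by apply: (@baer predT M X _ _ _ _ a p).
Qed.

(** The category is locally noetherian, so unions of injectives are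
    injective: by compactness only one term of the union is involved in an
    extension problem with simple cokernel, once it is cut down to finite
    length. *)
Lemma inj_union (A : nat -> C) (a : forall n, hom (A n) (A n.+1)) M
    (x : forall n, hom (A n) M) :
  (forall n, mono (a n)) -> is_colimit a x -> (forall n, injective_obj (A n)) ->
  injective_obj M.
Proof.
move=> am ax Ainj; apply: inj_crit => j X Y u p up f.
have Ss := simp_simple D j.
have [F [k [Ffl km pk]]] : exists F (k : hom F Y),
    [/\ finite_length F, mono k & p \c k <> 0].
  apply: contrapT => N; have [+ _] := Ss; apply; apply: epi_zero (se_epi up) _.
  apply: (fl_test HLA) => F k Ffl km; apply: contrapT => pk; apply: N.
  by exists F, k.
have pke := simple_epi HLA Ss pk; case: (epi_se HA pke) => F0 [l lpk].
have pkl : p \c (k \c l) = 0 by rewrite compA (se_0 lpk).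
case: (se_lift up pkl) => v uv.
have [n [g gE]] := fl_compact HLA (f \c v) am ax (fl_sub HLA (se_mono lpk) Ffl).
case: (Ainj n _ _ l g (se_mono lpk)) => g' g'l.
case: (ab_sum HA X F) => S [i1 [i2 [p1 [p2 [E11 E22 E12 E21 E]]]]].
pose e := u \c p1 + k \c p2.
have e1 : e \c i1 = u.
  by rewrite compDl (postE _ E11) (postE _ E21) comp0r addr0 compm1.
have e2 : e \c i2 = k.
  by rewrite compDl (postE _ E12) (postE _ E22) comp0r add0r compm1.
have ee : epi e.
  apply: epi0 => T t te.
  have tu : t \c u = 0 by rewrite -e1 compA te comp0l.
  case: (se_desc up tu) => s sp; rewrite -sp.
  suff -> : s = 0 by rewrite comp0l.
  by apply: epi_eq0 pke _; rewrite compA sp -e2 compA te comp0l.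
case: (epi_se HA ee) => R [m me].
pose d := f \c p1 + x n \c g' \c p2.
have dm : d \c m = 0.
  have em : u \c (p1 \c m) + k \c (p2 \c m) = 0.
    by rewrite !compA -compDl (se_0 me).
  have pkm : p \c k \c (p2 \c m) = 0.
    have := congr1 (comp p) em.
    by rewrite comp0r compDr !compA (se_0 up) !comp0l add0r.
  case: (se_lift lpk pkm) => s sE.
  have E1 : p1 \c m = - (v \c s).
    apply: (se_mono up); apply: (addIr (k \c (p2 \c m))).
    by rewrite em compNr compA uv -sE compA addNr.
  rewrite compDl -!compA E1 -sE (compA g') g'l compNr !compA gE.
  by rewrite -compA addNr.
case: (se_desc me dm) => g'' g''e; exists g''.
rewrite -e1 compA g''e compDl (postE _ E11) (postE _ E21).
by rewrite comp0r addr0 compm1.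
Qed.

(** An increasing sequence embeds into an increasing sequence of injectives in
    such a way that the cokernels form an increasing sequence as well: the next
    injective is the previous one plus one containing the successive
    quotient. *)
Lemma chain_emb (E : C -> Prop) (A : nat -> C) (a : forall n, hom (A n) (A n.+1)) :
  (forall X Y S (i1 : hom X S) (i2 : hom Y S) (p1 : hom S X) (p2 : hom S Y),
    is_biproduct i1 i2 p1 p2 -> E X -> E Y -> E S) ->
  (forall n, mono (a n)) ->
  (exists J (j : hom (A 0) J), [/\ mono j, injective_obj J & E J]) ->
  (forall n Q (q : hom (A n.+1) Q), short_exact (a n) q ->
    exists J (j : hom Q J), [/\ mono j, injective_obj J & E J]) ->
  exists (J : nat -> C) (b : forall n, hom (J n) (J n.+1))
    (j : forall n, hom (A n) (J n)),
    [/\ forall n, [/\ mono (j n), injective_obj (J n) & E (J n)],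
        forall n, mono (b n), forall n, j n.+1 \c a n = b n \c j n
      & forall n T (u : hom T (J n)) (v : hom T (A n.+1)),
          b n \c u = j n.+1 \c v -> exists w, j n \c w = u].
Proof.
move=> Esum am [J0 [j0 J0P]] emb.
pose good n (s : {J : C & hom (A n) J}) :=
  [/\ mono (projT2 s), injective_obj (projT1 s) & E (projT1 s)].
pose R n (s : {s | good n s}) (s' : {s | good n.+1 s}) :=
  exists b : hom (projT1 (sval s)) (projT1 (sval s')),
    [/\ mono b, projT2 (sval s') \c a n = b \c projT2 (sval s)
      & forall T (u : hom T (projT1 (sval s))) (v : hom T (A n.+1)),
          b \c u = projT2 (sval s') \c v -> exists w, projT2 (sval s) \c w = u].
have s0 : good 0 (existT _ J0 j0) by [].
have [n [[J j] [/= jm Ji JE]]|s [_ sR]] := @dep_rec _ R (exist _ _ s0).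
  case: (mono_se HA (am n)) => Q [q aq].
  case: (emb n Q q aq) => J' [j' [jm' Ji' JE']].
  case: (ab_sum HA J J') => S [i1 [i2 [p1 [p2 bp]]]].
  case: (bp) => E11 E22 E12 E21 Eid.
  case: (Ji _ _ (a n) j (am n)) => g ga.
  pose k := i1 \c g + i2 \c (j' \c q).
  have k1 : p1 \c k = g.
    by rewrite compDr !compA E11 E12 !comp0l addr0 comp1m.
  have k2 : p2 \c k = j' \c q.
    by rewrite compDr !compA E21 E22 !comp0l add0r comp1m.
  have kill T (v : hom T (A n.+1)) : p2 \c (k \c v) = 0 -> exists w, a n \c w = v.
    rewrite compA k2 -compA => /(mono_eq0 jm') /(se_lift aq) [w wE].
    by exists w.
  have km : mono k.
    apply: mono0 => T t kt; case: (kill T t) => [|w wt].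
      by rewrite kt comp0r.
    suff w0 : w = 0 by rewrite -wt w0 comp0r.
    apply: mono_eq0 jm _; rewrite -ga -compA wt -k1 -compA kt comp0r //.
  have kg : good n.+1 (existT _ S k).
    by split=> //=; [apply: (inj_biproduct bp) | apply: (Esum _ _ _ _ _ _ _ bp)].
  exists (exist _ _ kg), i1; split=> /=.
  - exact: se_mono (biproduct_se HA bp).
  - by rewrite compDl -!compA (se_0 aq) !comp0r addr0 ga.
  move=> T u v uv; case: (kill T v) => [|w wv].
    by rewrite -uv compA E21 comp0l.
  by exists w; rewrite -ga -compA wv -k1 -compA -uv compA E11 comp1m.
have [b bP] := dep_choice sR.
exists (fun n => projT1 (sval (s n))), b, (fun n => projT2 (sval (s n))).
split=> [n|n|n|n]; first exact: (svalP (s n)).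
all: by case: (bP n).
Qed.

Section Embedding.
Variable P : C -> Prop.
Hypothesis P0 : forall X, is_zero X -> P X.
Hypothesis PI : forall m, P (I m).
Hypothesis Pext : forall X Y Z (i : hom X Y) (p : hom Y Z),
  short_exact i p -> P X -> P Z -> P Y.
Hypothesis Pun : forall (A : nat -> C) (a : forall n, hom (A n) (A n.+1)) X
    (x : forall n, hom (A n) X),
  (forall n, mono (a n)) -> is_colimit a x -> (forall n, P (A n)) -> P X.

Lemma emb_fl X : finite_length X ->
  exists J (j : hom X J), [/\ mono j, injective_obj J & P J].
Proof.
elim=> [{}X X0|A {}X S i p _ [J [j [jm Ji JP]]] Ss ip].
  exists X, (idm X); split; [exact: iso_mono (iso_id X)| |exact: P0].
  by move=> A B a f _; exists 0; rewrite comp0l; apply/esym/zero_tgt.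
have [m [u ui]] := simp_all D Ss.
have um := mono_comp (@env_in_mono _ _ D m) (iso_mono ui).
case: (ab_sum HA J (I m)) => B [i1 [i2 [p1 [p2 bp]]]].
case: (bp) => E11 E22 E12 E21 Eid.
case: (Ji _ _ i j (se_mono ip)) => g gi.
pose k := i1 \c g + i2 \c (env_in D m \c u \c p).
have k1 : p1 \c k = g by rewrite compDr !compA E11 E12 !comp0l addr0 comp1m.
have k2 : p2 \c k = env_in D m \c u \c p.
  by rewrite compDr !compA E21 E22 !comp0l add0r comp1m.
exists B, k; split.
- apply: mono0 => T t kt.
  have pt : p \c t = 0.
    by apply: mono_eq0 um _; rewrite compA -k2 -compA kt comp0r.
  case: (se_lift ip pt) => w wE; suff w0 : w = 0 by rewrite -wE w0 comp0r.
  by apply: mono_eq0 jm _; rewrite -gi -compA wE -k1 -compA kt comp0r.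
- by apply: (inj_biproduct bp Ji); apply: env_inj.
- exact: Pext (biproduct_se HA bp) JP (PI m).
Qed.

(** The injectives obtained here are unions of finite sums of the [I m], so they
    share all properties [P] that are preserved by extensions and unions. *)
Lemma emb X : exists J (j : hom X J), [/\ mono j, injective_obj J & P J].
Proof.
case: (LA3 HLA X) => G Gfl.
have [|n||n Q q Gq|J [b [j [JP bm jE _]]]] :=
  @chain_emb P (fun n => G n) (fun n => fil_step G n).
- by move=> X1 Y S i1 i2 p1 p2 bp; apply: Pext (biproduct_se HA bp).
- exact: fil_step_mono.
- exact: (emb_fl (Gfl 0)).
- by apply: emb_fl; apply: (fl_quot HLA (se_epi Gq)).
case: (LA1 HLA b) => M [x bx].
have [|u uE] := colim_desc (fil_union G) (t := fun n => x n \c j n).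
  by move=> n; rewrite -compA jE compA bx.1.
exists M, u; split.
- by apply: (LA_mono HLA jE _ (fil_union G) bx uE) => n; case: (JP n).
- by apply: (inj_union bm bx) => n; case: (JP n).
- by apply: (Pun bm bx) => n; case: (JP n).
Qed.

End Embedding.

Lemma enough_inj X : exists J N (j : hom X J) (p : hom J N),
  injective_obj J /\ short_exact j p.
Proof.
have [||||J [j [jm Ji _]]] := @emb (fun _ => True) _ _ _ _ X; try by [].
by case: (mono_se HA jm) => N [p jp]; exists J, N, j, p.
Qed.

End Injective.

(** * Vanishing of Ext *)

Section Ext.
Context {K : fieldType} {C : linCat K} (D : LAplus C).
Implicit Types A B F X Y Z M N T J W : C.
Let HLA : locally_artinian C := LAp_LA D.
Let HA : abelian C := LA_abelian HLA.
Notation L := (simp D).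

(** [extS n X M] and [ev n X M] say that [Ext^(n+1)(X, M) = 0] and
    [Ext^n(X, M) = 0], by dimension shifting along cosyzygies. Quantifying over
    all cosyzygies of [M] makes the shift from [M] to [N] immediate; by [ev1I] and
    [ev_shift] a single one suffices. *)
Fixpoint extS n X M : Prop :=
  match n with
  | 0 => forall J N (j : hom M J) (p : hom J N), injective_obj J ->
      short_exact j p -> forall f : hom X N, exists g : hom X J, p \c g = f
  | n'.+1 => forall J N (j : hom M J) (p : hom J N), injective_obj J ->
      short_exact j p -> extS n' X N
  end.

Definition ev n X M : Prop :=
  match n with 0 => forall f : hom X M, f = 0 | n'.+1 => extS n' X M end.

Lemma lift_extends X M J N (j : hom M J) (p : hom J N) : injective_obj J ->
  short_exact j p -> (forall f : hom X N, exists g : hom X J, p \c g = f) ->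
  extends X M.
Proof.
move=> Ji jp lift A B a q aq f; case: (Ji _ _ a (j \c f) (se_mono aq)) => g ga.
have pga : p \c g \c a = 0 by rewrite -compA ga compA (se_0 jp) comp0l.
case: (se_desc aq pga) => s sq; case: (lift s) => t ts.
have E : p \c (g - t \c q) = 0 by rewrite compBr compA ts sq subrr.
case: (se_lift jp E) => u uE; exists u; apply: (se_mono jp).
by rewrite compA uE compBl -compA (se_0 aq) comp0r subr0.
Qed.

Lemma extends_lift X M Y N (j : hom M Y) (p : hom Y N) (f : hom X N) :
  extends X M -> short_exact j p -> exists g : hom X Y, p \c g = f.
Proof.
move=> XM jp; case: (pullback HA p f) => P [a [b pb]].
case: (pullback_se HA jp pb) => k [kb ak]; case: (XM _ _ k b kb (idm M)) => r rk.
have E : (idm P - k \c r) \c k = 0.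
  by rewrite compBl comp1m -compA rk compm1 subrr.
case: (se_desc kb E) => s sb; exists (a \c s).
have bs : b \c s = idm X.
  apply: (se_epi kb); rewrite comp1m -compA sb compBr compA (se_0 kb).
  by rewrite comp0l subr0 compm1.
by case: pb => pf _; rewrite compA pf -compA bs compm1.
Qed.

Lemma ev1_extends X M : ev 1 X M <-> extends X M.
Proof.
split=> [XM|XM J N j p _ jp f]; last exact: extends_lift XM jp.
case: (enough_inj D M) => J [N [j [p [Ji jp]]]].
exact: lift_extends Ji jp (XM _ _ j p Ji jp).
Qed.

Lemma ev1_lift X M Y N (j : hom M Y) (p : hom Y N) (f : hom X N) :
  ev 1 X M -> short_exact j p -> exists g : hom X Y, p \c g = f.
Proof. by move=> /ev1_extends; apply: extends_lift. Qed.

Lemma ev1I X M J N (j : hom M J) (p : hom J N) : injective_obj J ->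
  short_exact j p -> (forall f : hom X N, exists g : hom X J, p \c g = f) ->
  ev 1 X M.
Proof. by move=> Ji jp H; apply/ev1_extends; apply: lift_extends Ji jp H. Qed.

Lemma inj_coker J J' N (j : hom J J') (p : hom J' N) : injective_obj J ->
  injective_obj J' -> short_exact j p -> injective_obj N.
Proof.
move=> Ji Ji' jp; case: (Ji _ _ j (idm J) (se_mono jp)) => r rj.
have E : (idm J' - j \c r) \c j = 0.
  by rewrite compBl comp1m -compA rj compm1 subrr.
case: (se_desc jp E) => s sp.
have ps : p \c s = idm N.
  apply: (se_epi jp); rewrite comp1m -compA sp compBr compA (se_0 jp).
  by rewrite comp0l subr0 compm1.
move=> A B a f am; case: (Ji' _ _ a (s \c f) am) => g ga.
by exists (p \c g); rewrite -compA ga compA ps comp1m.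
Qed.

Lemma ev_inj n X J : injective_obj J -> ev n.+1 X J.
Proof.
elim: n J => [|n IH] J Ji.
  by apply/ev1_extends => A B a p ap f; apply: Ji (se_mono ap).
by move=> J' N j p Ji' jp; apply: IH; apply: inj_coker jp.
Qed.

(** The long exact sequence for [M -> Y -> N], as far as vanishing is
    concerned, is proved by comparing cosyzygies: [Y] and [M] are both embedded
    into one injective [J], and [N -> J / M -> J / Y] is exact. *)
Lemma cosyzygies M Y N (i : hom M Y) (p : hom Y N) : short_exact i p ->
  exists J Z W (j : hom Y J) (q : hom J Z) (r : hom J W) (a : hom N W)
    (b : hom W Z),
    [/\ injective_obj J, short_exact j q, short_exact (j \c i) r,
        short_exact a b & a \c p = r \c j /\ b \c r = q].
Proof.
move=> ip; case: (enough_inj D Y) => J [Z [j [q [Ji jq]]]].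
case: (mono_se HA (mono_comp (se_mono jq) (se_mono ip))) => W [r jir].
case: (se_comp HA ip jq jir) => a [b [ab E1 E2]].
by exists J, Z, W, j, q, r, a, b.
Qed.

Section Level.
Variable X : C.

Let les_mid n := forall M Y N (i : hom M Y) (p : hom Y N), short_exact i p ->
  ev n X M -> ev n X N -> ev n X Y.
Let les_right n := forall M Y N (i : hom M Y) (p : hom Y N), short_exact i p ->
  ev n X Y -> ev n.+1 X M -> ev n X N.
Let les_left n := forall M Y N (i : hom M Y) (p : hom Y N), short_exact i p ->
  ev n X N -> ev n.+1 X Y -> ev n.+1 X M.
Let retr n := forall M Y (s : hom M Y) (r : hom Y M), r \c s = idm M ->
  ev n X Y -> ev n X M.
Let shift n := forall M J N (j : hom M J) (p : hom J N), injective_obj J ->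
  short_exact j p -> ev n X N -> ev n.+1 X M.

(** Schanuel: two cosyzygies of the same object become isomorphic after adding
    injectives; all that matters is that [N] is a retract of [N' + J]. *)
Lemma schanuel n : les_mid n.+1 -> retr n.+1 -> shift n.+1.
Proof.
move=> mid rt M J' N' j' p' Ji' jp' Nv J N j p Ji jp.
case: (Ji' _ _ j j' (se_mono jp)) => al alj.
case: (Ji _ _ j' j (se_mono jp')) => be bej.
have E1 : (idm J - be \c al) \c j = 0.
  by rewrite compBl comp1m -compA alj bej subrr.
case: (se_desc jp E1) => ga gap.
have E2 : p' \c al \c j = 0 by rewrite -compA alj (se_0 jp').
case: (se_desc jp E2) => al' al'p.
have E3 : p \c be \c j' = 0 by rewrite -compA bej (se_0 jp).
case: (se_desc jp' E3) => be' be'p.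
have id : be' \c al' + p \c ga = idm N.
  apply: (se_epi jp).
  rewrite compDl -!compA al'p gap compA be'p compBr compm1 comp1m compA.
  by rewrite addrC subrK.
case: (ab_sum HA N' J) => S [i1 [i2 [p1 [p2 bp]]]].
case: (bp) => E11 E22 E12 E21 Eid.
apply: (rt _ S (i1 \c al' + i2 \c ga) (be' \c p1 + p \c p2)).
  rewrite compDl !compDr !compA !(postE _ E11) !(postE _ E22).
  by rewrite !(postE _ E12) !(postE _ E21) !comp0r !comp0l !compm1 addr0 add0r.
by apply: mid (biproduct_se HA bp) Nv _; apply: ev_inj.
Qed.

Lemma les_mid0 : les_mid 0.
Proof.
move=> M Y N i p ip M0 N0 f; case: (se_lift ip (N0 (p \c f))) => u <-.
by rewrite (M0 u) comp0r.
Qed.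

Lemma les_right0 : les_right 0.
Proof.
move=> M Y N i p ip Y0 M1 f; case: (ev1_lift f M1 ip) => g <-.
by rewrite (Y0 g) comp0r.
Qed.

Lemma les_left0 : les_left 0.
Proof.
move=> M Y N i p ip N0 Y1.
case: (cosyzygies ip) => J [Z [W [j [q [r [a [b [Ji jq jir ab [E1 E2]]]]]]]]].
apply: (ev1I Ji jir) => f; case: (ev1_lift (b \c f) Y1 jq) => g gE.
have E : b \c (f - r \c g) = 0 by rewrite compBr compA E2 gE subrr.
case: (se_lift ab E) => u; rewrite (N0 u) comp0r => /esym/subr0_eq ->.
by exists g.
Qed.

Lemma retr0 : retr 0.
Proof.
move=> M Y s r rs Y0 f; rewrite -[f]comp1m -rs -compA.
by rewrite (Y0 (s \c f)) comp0r.
Qed.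

Lemma retr1 : retr 1.
Proof.
move=> M Y s r rs /ev1_extends Y1; apply/ev1_extends => A B a p ap f.
case: (Y1 _ _ a p ap (s \c f)) => g ga; exists (r \c g).
by rewrite -compA ga compA rs comp1m.
Qed.

Lemma les_mid1 : les_mid 1.
Proof.
move=> M Y N i p ip M1 N1.
case: (cosyzygies ip) => J [Z [W [j [q [r [a [b [Ji jq jir ab [E1 E2]]]]]]]]].
apply: (ev1I Ji jq) => f; case: (ev1_lift f N1 ab) => g gE.
case: (ev1_lift g M1 jir) => h hE; exists h.
by rewrite -E2 -compA hE.
Qed.

Lemma les_right1 : les_right 1.
Proof.
move=> M Y N i p ip Y1 M2.
case: (cosyzygies ip) => J [Z [W [j [q [r [a [b [Ji jq jir ab [E1 E2]]]]]]]]].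
have /ev1_extends W1 : ev 1 X W := M2 _ _ _ _ Ji jir.
apply/ev1_extends => A B u v uv f.
case: (W1 _ _ u v uv (a \c f)) => g gu.
have bgu : b \c g \c u = 0 by rewrite -compA gu compA (se_0 ab) comp0l.
case: (se_desc uv bgu) => h hv; case: (ev1_lift h Y1 jq) => h' h'E.
have E : b \c (g - r \c h' \c v) = 0.
  by rewrite compBr !compA E2 h'E hv subrr.
case: (se_lift ab E) => g' g'E; exists g'; apply: (se_mono ab).
by rewrite compA g'E compBl -!compA (se_0 uv) !comp0r subr0.
Qed.

Lemma retr_step n : shift n -> retr n -> retr n.+1.
Proof.
case: n => [_ _|n sh rt M Y s r rs Yv]; first exact: retr1.
case: (enough_inj D M) => J1 [N1 [j1 [q1 [Ji1 jq1]]]].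
case: (enough_inj D Y) => J2 [N2 [j2 [q2 [Ji2 jq2]]]].
case: (ab_sum HA J1 J2) => S [i1 [i2 [p1 [p2 bp]]]].
case: (bp) => E11 E22 E12 E21 Eid.
pose e := i1 \c (j1 \c r) + i2 \c (j2 \c (idm Y - s \c r)).
have e1 : p1 \c e = j1 \c r.
  by rewrite compDr !compA E11 E12 !comp0l addr0 comp1m.
have e2 : p2 \c e = j2 \c (idm Y - s \c r).
  by rewrite /e [LHS]compDr !compA E21 E22 !comp0l add0r comp1m.
have em : mono e.
  apply: mono0 => T t et.
  have rt0 : r \c t = 0.
    by apply: mono_eq0 (se_mono jq1) _; rewrite compA -e1 -compA et comp0r.
  have : (idm Y - s \c r) \c t = 0.
    by apply: mono_eq0 (se_mono jq2) _; rewrite compA -e2 -compA et comp0r.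
  by rewrite compBl comp1m -compA rt0 comp0r subr0.
have es : e \c s = i1 \c j1.
  rewrite compDl -!compA compBl comp1m -compA rs !compm1 subrr.
  by rewrite !comp0r addr0.
case: (mono_se HA em) => N [q eq].
have qi1j : q \c i1 \c j1 = 0 by rewrite -compA -es compA (se_0 eq) comp0l.
case: (se_desc jq1 qi1j) => nu nuE.
have q1p1e : q1 \c p1 \c e = 0 by rewrite -compA e1 compA (se_0 jq1) comp0l.
case: (se_desc eq q1p1e) => mu muE.
have munu : mu \c nu = idm N1.
  apply: (se_epi jq1).
  by rewrite -compA nuE compA muE comp1m -compA E11 compm1.
apply: (sh _ _ _ _ _ Ji1 jq1); apply: (rt _ _ _ _ munu).
by apply: Yv eq; apply: (inj_biproduct bp).
Qed.

Lemma les_all n : [/\ les_mid n.+1, les_right n.+1 & retr n.+1].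
Proof.
elim: n => [|n [mid right rt]].
  by split; [exact: les_mid1 | exact: les_right1 | exact: retr1].
have sh := schanuel mid rt.
have left : les_left n.+1.
  move=> M Y N i p ip Nv Yv.
  case: (cosyzygies ip) => J [Z [W [j [q [r [a [b [Ji jq jir ab _]]]]]]]].
  by apply: (sh _ _ _ _ _ Ji jir); apply: mid ab Nv _; apply: Yv jq.
split; last exact: retr_step.
- move=> M Y N i p ip Mv Nv.
  case: (cosyzygies ip) => J [Z [W [j [q [r [a [b [Ji jq jir ab _]]]]]]]].
  by apply: (sh _ _ _ _ _ Ji jq); apply: right ab _ Nv; apply: Mv jir.
move=> M Y N i p ip Yv Mv.
case: (cosyzygies ip) => J [Z [W [j [q [r [a [b [Ji jq jir ab _]]]]]]]].
by apply: left ab _ _; [apply: Yv jq | apply: Mv jir].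
Qed.

Lemma ev_mid n : les_mid n.
Proof. by case: n => [|n]; [exact: les_mid0 | case: (les_all n)]. Qed.

Lemma ev_right n : les_right n.
Proof. by case: n => [|n]; [exact: les_right0 | case: (les_all n)]. Qed.

Lemma ev_retract n : retr n.
Proof. by case: n => [|n]; [exact: retr0 | case: (les_all n)]. Qed.

Lemma ev_shift n M J N (j : hom M J) (p : hom J N) : injective_obj J ->
  short_exact j p -> ev n.+1 X N -> ev n.+2 X M.
Proof. by case: (les_all n) => mid _ rt; apply: schanuel. Qed.

Lemma ev_left n : les_left n.
Proof.
case: n => [|n]; first exact: les_left0.
move=> M Y N i p ip Nv Yv.
case: (cosyzygies ip) => J [Z [W [j [q [r [a [b [Ji jq jir ab _]]]]]]]].
by apply: (ev_shift Ji jir); apply: ev_mid ab Nv _; apply: Yv jq.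
Qed.

Lemma ev_iso n M Y (f : hom M Y) : iso f -> ev n X Y -> ev n X M.
Proof. by case=> g [gf _]; apply: ev_retract gf. Qed.

Lemma ev_zero n M : is_zero M -> ev n X M.
Proof.
case: n => [|n] M0; first by move=> f; apply: zero_tgt.
apply: ev_inj => A B a f _; exists 0; rewrite comp0l; exact/esym/zero_tgt.
Qed.

End Level.

(** For [n > 0] the chain is embedded into a chain of injectives; the cokernels
    again form an increasing chain, so the degree drops. In degree 0 the object
    [X] is compact. *)
Lemma ev_union n X (A : nat -> C) (a : forall n, hom (A n) (A n.+1)) M
    (x : forall n, hom (A n) M) : finite_length X ->
  (forall n, mono (a n)) -> is_colimit a x -> (forall m, ev n X (A m)) -> ev n X M.
Proof.
move=> Xfl; elim: n A a M x => [|n IH] A a M x am ax Av.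
  move=> f; have [m [g <-]] := fl_compact HLA f am ax Xfl.
  by rewrite (Av m g) comp0r.
have emb Y : exists J (j : hom Y J), [/\ mono j, injective_obj J & True].
  by case: (enough_inj D Y) => J [N [j [p [Ji /se_mono jm]]]]; exists J, j.
have [//|//|||J [b [j [JP bm jE jpb]]]] := @chain_emb _ _ D (fun _ => True) A a.
- exact: emb.
- by move=> m Q q _; apply: emb.
have jm m : mono (j m) by case: (JP m).
have Ji m : injective_obj (J m) by case: (JP m).
case: (chain_coker HLA jE jm) => N [d [g [gb jg]]].
have dm m : mono (d m).
  apply: (coker_mono HA (b := b m) (jg m) (jg m.+1)) => [|T u v]; first by rewrite gb.
  exact: jpb.
case: (LA1 HLA b) => Y [y by_].
case: (LA_se HLA jE gb jg ax by_) => Z [z [F [G [dz FE GE FG]]]].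
have Yi := inj_union D bm by_ Ji.
case: n => [|n] in IH Av *.
  apply: (ev1I Yi FG) => f; have [m [h <-]] := fl_compact HLA f dm dz Xfl.
  case: (ev1_lift h (Av m) (jg m)) => h' <-; exists (y m \c h').
  by rewrite compA GE compA.
apply: (ev_shift Yi FG); apply: (IH N d Z z dm dz) => m.
exact: (Av m _ _ _ _ (Ji m) (jg m)).
Qed.

(** * Comparison with injective resolutions *)

Lemma exact_mono X Y Z (f : hom X Y) (g : hom Y Z) : mono f -> exact f g ->
  is_kernel g f.
Proof.
move=> fm [A [i [[Q [q [fq qi]]] gi]]]; have fqs := coker_se HA fm fq.
have im := kernel_mono gi; case: gi => gi gU; case: qi => qi qU.
apply: kernelI => //.
  by case: (qU _ f (se_0 fqs)) => u [<- _]; rewrite compA gi comp0l.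
move=> T t gt; case: (gU _ t gt) => u [ut _]; apply: (se_lift fqs).
by rewrite -ut compA qi comp0l.
Qed.

Lemma resolution_ev n X M (J : nat -> C) (aug : hom M (J 0))
    (d : forall n, hom (J n) (J n.+1)) :
  (forall n, injective_obj (J n)) -> mono aug -> exact aug (d 0) ->
  (forall n, exact (d n) (d n.+1)) ->
  (forall f : hom X (J n), d n \c f = 0 ->
    (match n as n return hom X (J n) -> Prop with
     | 0 => fun f => f = 0
     | n'.+1 => fun f => exists g : hom X (J n'), d n' \c g = f end) f) <->
  ev n X M.
Proof.
elim: n M J aug d => [|n IH] M J aug d Ji augm ex0 ex.
  have [da U] := exact_mono augm ex0; split=> [H f|H f df].
    apply: mono_eq0 augm _; apply: H.
    by rewrite compA da comp0l.
  by case: (U _ f df) => u [<- _]; rewrite (H u) comp0r.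
have [da U] := exact_mono augm ex0.
case: (mono_se HA augm) => N [q aq]; case: (se_desc aq da) => a1 a1q.
have a1m : mono a1.
  apply: mono0 => T t a1t; case: (epi_cover HA t (se_epi aq)) => T' [e [u [ee qu]]].
  apply: epi_eq0 ee _; rewrite -qu.
  have du : d 0 \c u = 0 by rewrite -a1q -compA qu compA a1t comp0l.
  by case: (U _ u du) => w [<- _]; rewrite compA (se_0 aq) comp0l.
have ex1 : exact a1 (d 1).
  case: (ex 0) => A [i [[Q [c [[cd cU] ci]]] di]]; exists A, i; split=> //.
  exists Q, c; split=> //; split.
    by apply: epi_eq0 (se_epi aq) _; rewrite -compA a1q.
  by move=> T t ta1; apply: cU; rewrite -a1q compA ta1 comp0l.
case: n IH => [|n] IH.
  have [d1a1 U1] := exact_mono a1m ex1; split=> [H|H f df].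
    apply: (ev1I (Ji 0) aq) => f; have [|g gE] := H (a1 \c f).
      by rewrite compA d1a1 comp0l.
    by exists g; apply: a1m; rewrite compA a1q.
  case: (U1 _ f df) => u [<- _]; case: (ev1_lift u H aq) => g <-.
  by exists g; rewrite compA a1q.
have S := IH N (fun n => J n.+1) a1 (fun n => d n.+1) (fun n => Ji n.+1) a1m ex1
  (fun n => ex n.+1).
split=> [H|H].
  by apply: (ev_shift (Ji 0) aq); apply/S.
by apply/S; apply: (H _ _ _ _ (Ji 0) aq).
Qed.

Lemma resolution_exists M : inhabited (injective_resolution M).
Proof.
pose R (n : nat) Z Z' := exists J (j : hom Z J) (p : hom J Z'),
  injective_obj J /\ short_exact j p.
have [n Z|Z [Z0 ZP]] := @dep_rec (fun _ => obj C) R M.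
  by case: (enough_inj D Z) => J [N [j [p [Ji jp]]]]; exists N, J, j, p.
subst M.
have [n|J [j jP]] := @hom_choice _ _ Z (fun n J j => injective_obj J /\
    exists p : hom J (Z n.+1), short_exact j p).
  by case: (ZP n) => J [j [p [Ji jp]]]; exists J, j; split=> //; exists p.
have [n|p pP] := @dep_choice (fun n => hom (J n) (Z n.+1))
  (fun n p => short_exact (j n) p); first by case: (jP n).
pose d n := j n.+1 \c p n.
have jd n : is_kernel (d n) (j n).
  apply: kernelI.
  - by rewrite /d -compA (se_0 (pP n)) comp0r.
  - exact: se_mono (pP n).
  move=> T t dt; apply: (se_lift (pP n)); apply: mono_eq0 (se_mono (pP n.+1)) _.
  by rewrite compA.
have ex n : exact (d n) (d n.+1).
  exists (Z n.+1), (j n.+1); split=> //; exists (Z n.+2), (p n.+1).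
  split; last by case: (pP n.+1).
  apply: cokernelI.
  - by rewrite compA (se_0 (pP n.+1)) comp0l.
  - exact: se_epi (pP n.+1).
  move=> T t td; apply: (se_desc (pP n.+1)); apply: epi_eq0 (se_epi (pP n)) _.
  by rewrite -compA.
have ex0 : exact (j 0) (d 0).
  exists (Z 0), (j 0); split=> //; exists (Z 1), (p 0).
  by case: (pP 0).
by split; exact: (InjectiveResolution (fun n => (jP n).1) (se_mono (pP 0)) ex0 ex).
Qed.

Lemma Ext_zeroP n X M : Ext_zero n X M <-> ev n X M.
Proof.
have E (R : injective_resolution M) := @resolution_ev n X M (res R) (res_aug R)
  (res_d R) (@res_inj _ _ _ R) (@res_aug_mono _ _ _ R) (res_exact0 R)
  (@res_exactS _ _ _ R).
split=> [[R H]|H].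
  apply/E => f df; have := H f df; rewrite /Ext_coboundary.
  by case: (n) f df.
case: (resolution_exists M) => R; exists R => f df.
have := (E R).2 H f df; rewrite /Ext_coboundary.
by case: (n) f df.
Qed.

End Ext.

(** * Acyclic objects for the canonical filtration *)

Section Acyclic.
Context {K : fieldType} {C : linCat K} (D : LAplus C).
Implicit Types A B F X Y Z M N T J W P Q : C.
Let HLA : locally_artinian C := LAp_LA D.
Let HA : abelian C := LA_abelian HLA.
Notation L := (simp D).

Lemma simp_fl j : finite_length (L j).
Proof.
case: (ab_zero HA) => Z Z0.
apply: (FiniteLengthS (FiniteLength0 Z0) (simp_simple D j)).
exact: (se_idl HA (L j) Z0).
Qed.

Definition perp k Y : Prop := forall j, (j < k)%N -> forall n, ev n (L j) Y.

(** [M'] is the largest subobject of [M] with factors of index below [k], and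
    [perp k M''] says that the higher derived functors of this subobject functor
    vanish on [M]. *)
Definition splitting k M M' M'' (i : hom M' M) (p : hom M M'') : Prop :=
  [/\ short_exact i p, tors D (below k) M' & perp k M''].

Definition acyc k M : Prop :=
  exists M' M'' (i : hom M' M) (p : hom M M''), splitting k i p.

Lemma perp_hom0 k X Y (f : hom X Y) : tors D (below k) X -> perp k Y -> f = 0.
Proof. by move=> Xt Yp; apply: (tors_hom0 _ Xt) => j jk g; apply: (Yp j jk 0). Qed.

Lemma perp_extends k X Y : tors D (below k) X -> perp k Y -> extends X Y.
Proof.
move=> Xt Yp; apply: baer Xt _ => j jk; apply/(ev1_extends D).
exact: (Yp j jk 1).
Qed.

Lemma perp_ext k X Y Z (i : hom X Y) (p : hom Y Z) : short_exact i p ->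
  perp k X -> perp k Z -> perp k Y.
Proof. by move=> ip Xp Zp j jk n; exact: (ev_mid D ip (Xp j jk n) (Zp j jk n)). Qed.

(** Splittings are functorial, as there are no maps from a torsion object to one
    in [perp k]. For the same reason the intersection of [M] with [J'] is contained
    in [M'], so that monomorphisms induce monomorphisms of quotients. *)
Lemma splitting_map k M M' M'' (i : hom M' M) (p : hom M M'') J J' J''
    (j : hom J' J) (q : hom J J'') (f : hom M J) :
  splitting k i p -> splitting k j q -> mono f ->
  exists (f' : hom M' J') (f'' : hom M'' J''),
    [/\ j \c f' = f \c i, f'' \c p = q \c f & mono f''].
Proof.
move=> [ip M't M''p] [jq J't J''p] fm.
have qfi : q \c (f \c i) = 0 by apply: perp_hom0 M't J''p.
case: (se_lift jq qfi) => f' f'E.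
have qfi' : q \c f \c i = 0 by rewrite -compA.
case: (se_desc ip qfi') => f'' f''E; exists f', f''; split=> //.
apply: (coker_mono HA ip jq f''E) => T u v uv.
case: (ab_ker HA (q \c f)) => A [l lk]; have lm := kernel_mono lk.
case: lk => l0 lU.
have ql : q \c (f \c l) = 0 by rewrite compA.
case: (se_lift jq ql) => g gE.
have gm : mono g by apply: (@mono_compr _ _ _ _ _ j); rewrite gE; apply: mono_comp.
have At : tors D (below k) A := tors_sub gm J't.
have pl : p \c l = 0 by apply: perp_hom0 At M''p.
have [|w [wu _]] := lU _ u.
  by rewrite -compA uv compA (se_0 jq) comp0l.
by apply: (se_lift ip); rewrite -wu compA pl comp0l.
Qed.

Lemma acyc_zero k M : is_zero M -> acyc k M.
Proof.
move=> M0; exists M, M, (idm M), 0; split; first exact: se_idr.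
  exact: tors_zero.
by move=> j _ n; apply: (ev_zero D).
Qed.

Lemma acyc_perp k M : perp k M -> acyc k M.
Proof.
move=> Mp; case: (ab_zero HA) => Z Z0; exists Z, M, 0, (idm M); split=> //.
  exact: se_idl.
exact: tors_zero.
Qed.

Lemma acyc_tors k M : tors D (below k) M -> acyc k M.
Proof.
move=> Mt; case: (ab_zero HA) => Z Z0; exists M, Z, (idm M), 0; split=> //.
  exact: se_idr.
by move=> j _ n; apply: (ev_zero D).
Qed.

(** The torsion part of the quotient lifts to the middle object, because
    [perp k] kills the obstruction. *)
Lemma acyc_ext k X Y Z (f : hom X Y) (g : hom Y Z) : short_exact f g ->
  acyc k X -> acyc k Z -> acyc k Y.
Proof.
move=> fg [X' [X'' [i [p [ip X't X''p]]]]] [Z' [Z'' [j [q [jq Z't Z''p]]]]].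
have fim := mono_comp (se_mono fg) (se_mono ip).
case: (mono_se HA fim) => Y1 [r fir].
case: (se_comp HA ip fg fir) => a [b [ab _ br]].
case: (se_comp' HA ab jq) => E [e [h [s [eqb hs eh be]]]].
case: (perp_extends Z't X''p hs (idm X'')) => ret retE.
have E0 : (idm E - h \c ret) \c h = 0.
  by rewrite compBl comp1m -compA retE compm1 subrr.
case: (se_desc hs E0) => t tE.
have retm : short_exact t ret.
  have st : s \c t = idm Z'.
    apply: (se_epi hs); rewrite -compA tE compBr compm1 compA (se_0 hs) comp0l.
    by rewrite subr0 comp1m.
  apply: (seI HA).
  - apply: (se_epi hs); rewrite -compA tE compBr compm1 compA retE comp1m.
    by rewrite subrr comp0l.
  - by apply: (@mono_compr _ _ _ _ _ s); rewrite st; apply: iso_mono (iso_id _).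
  - by apply: (@epi_compl _ _ _ _ _ _ h); rewrite retE; apply: iso_epi (iso_id _).
  move=> T u ru; exists (s \c u); rewrite compA tE compBl comp1m -compA ru.
  by rewrite comp0r subr0.
have etm := mono_comp (se_mono eqb) (se_mono retm).
case: (mono_se HA etm) => W [w etw].
case: (se_comp HA retm eqb etw) => a1 [b1 [ab1 _ _]].
case: (se_comp' HA fir etw) => Y' [y [h1 [r1 [yw hr1 _ _]]]].
exists Y', W, y, (w \c r); split=> //.
  exact: tors_ext hr1 X't Z't.
exact: perp_ext ab1 X''p Z''p.
Qed.

(** With [N'' = J'' / M''] the long exact sequence gives [perp k N'']. The kernel
    [N'] of [N -> N''] is torsion because it is a quotient of [J']: modulo [M],
    every element of [J] that dies in [N''] comes from [J']. *)
Lemma acyc_coker k M J N (f : hom M J) (g : hom J N) : short_exact f g ->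
  acyc k M -> acyc k J -> acyc k N.
Proof.
move=> fg [M' [M'' [i [p Ms]]]] [J' [J'' [j [q Js]]]].
have [f' [f'' [f'E f''E f''m]]] := splitting_map Ms Js (se_mono fg).
case: Ms => ip M't M''p; case: Js => jq J't J''p.
case: (mono_se HA f''m) => N'' [c fc].
have cqf : c \c q \c f = 0 by rewrite -compA -f''E compA (se_0 fc) comp0l.
case: (se_desc fg cqf) => n nE.
have ne : epi n.
  by apply: (@epi_compl _ _ _ _ _ _ g); rewrite nE; apply: epi_comp (se_epi fc) (se_epi jq).
case: (epi_se HA ne) => N' [l ln].
case: (se_comp' HA fg ln) => E [e [h [r [eng hr eh ge]]]].
exists N', N'', l, n; split=> //; last first.
  move=> m mk t; apply: (ev_right D fc); first exact: J''p.
  exact: M''p.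
have ngj : (n \c g) \c j = 0 by rewrite nE -compA (se_0 jq) comp0r.
case: (se_lift eng ngj) => s sE.
move=> m mk t; apply: epi_eq0 (se_epi hr) _.
have cqe : c \c (q \c e) = 0 by rewrite compA -nE (se_0 eng).
case: (se_lift fc cqe) => w wE.
case: (epi_cover HA w (se_epi ip)) => T [d [u [de pu]]].
have qz : q \c (e \c d - f \c u) = 0.
  by rewrite compBr !compA -f''E -wE -!compA pu subrr.
case: (se_lift jq qz) => v vE.
have dE : d = h \c u + s \c v.
  by apply: (se_mono eng); rewrite compDr !compA eh sE vE addrC subrK.
apply: epi_eq0 de _; rewrite dE compDr.
rewrite !compA -(compA t r h) (se_0 hr) comp0r comp0l add0r.
by rewrite (J't m mk (t \c r \c s)) comp0l.
Qed.

Lemma acyc_union k (A : nat -> C) (a : forall n, hom (A n) (A n.+1)) M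
    (x : forall n, hom (A n) M) :
  (forall n, mono (a n)) -> is_colimit a x -> (forall n, acyc k (A n)) -> acyc k M.
Proof.
move=> am ax Aa.
have [n|s sP] := @dep_choice (fun n => {A' : C & hom A' (A n)})
  (fun n s => exists A'' (p : hom (A n) A''), splitting k (projT2 s) p).
  by case: (Aa n) => A' [A'' [i [p S]]]; exists (existT _ A' i), A'', p.
have [A'' [p pP]] := @hom_choice _ _ A
  (fun n A'' (p : hom (A n) A'') => splitting k (projT2 (s n)) p) sP.
have smap n := splitting_map (pP n) (pP n.+1) (am n).
have [a' a'P] := dep_choice smap; have [a'' {a'P}aP] := dep_choice a'P.
case: (LA1 HLA a') => M' [x' ax'].
have [n|n|n|M'' [x'' [i [q [ax'' _ _ iq]]]]] :=
  LA_se HLA (a := a') (b := a) (d := a'') (f := fun n => projT2 (s n)) (g := p)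
    _ _ _ ax' ax.
- by case: (aP n).
- by case: (aP n).
- by case: (pP n).
exists M', M'', i, q; split=> //.
  by apply: tors_colim ax' _ => n; case: (pP n).
move=> j jk n; apply: (ev_union D (simp_fl j) _ ax'') => m; first by case: (aP m).
by case: (pP m) => _ _; apply.
Qed.

(** * Vanishing for acyclic objects *)

Section Vanishing.
Hypothesis acyc_emb : forall X, exists J (j : hom X J),
  [/\ mono j, injective_obj J & forall k, acyc k J].

(** The vanishing of [Ext^1] passes from [M] to its torsion part [M'], because
    [M''] has no maps from the [L j]. By [baer], [M'] is then injective relative
    to torsion objects, such as the cokernel of [M' -> J']. *)
Lemma splitting_retract k M M' M'' (i : hom M' M) (p : hom M M'') J J' J''
    (j : hom J' J) (q : hom J J'') (f : hom M J) :
  splitting k i p -> splitting k j q -> mono f ->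
  (forall l, (l < k)%N -> ev 1 (L l) M) ->
  exists (s : hom M' J') (r : hom J' M'), r \c s = idm M'.
Proof.
move=> Ms Js fm M1; have [s [_ [sE _ _]]] := splitting_map Ms Js fm.
case: Ms => ip M't M''p; case: Js => _ J't _.
have sm : mono s.
  apply: (@mono_compr _ _ _ _ _ j); rewrite sE.
  exact: mono_comp fm (se_mono ip).
case: (mono_se HA sm) => Q [c sc]; exists s.
apply: (@baer _ _ D (below k) M' Q _ _ _ _ _ c sc); last first.
  move=> l lk; apply/(ev1_extends D); apply: (ev_left D ip); last exact: M1.
  exact: (M''p l lk 0).
exact: tors_quot (se_epi sc) J't.
Qed.

Lemma ev_of_ev1 k M : acyc k M -> (forall j, (j < k)%N -> ev 1 (L j) M) ->
  forall j n, (j < k)%N -> ev n.+1 (L j) M.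
Proof.
move=> [M' [M'' [i [p Ms]]]] M1 j n jk.
case: (acyc_emb M) => J [f [fm Ji /(_ k) [J' [J'' [u [q Js]]]]]].
have [s [r rs]] := splitting_retract Ms Js fm M1.
case: Ms Js => [ip M't M''p] [uq J't J''p].
apply: (ev_mid D ip); last exact: M''p.
by apply: (ev_retract D rs); apply: (ev_left D uq); [apply: J''p | apply: (ev_inj D)].
Qed.

(** A nonzero torsion part would contribute some [L j], [j < k], to the socle. *)
Lemma splitting_perp k M M' M'' (i : hom M' M) (p : hom M M'') :
  splitting k i p -> (forall j, (j < k)%N -> ev 0 (L j) M) -> iso p.
Proof.
move=> [ip M't M''p] M0; apply: (se_zero_l HA ip); apply: mono_zero (se_mono ip) _.
by apply: tors_hom0 M't _ => j jk; apply: M0.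
Qed.

Lemma acyc_shift n M : (forall k, acyc k M) ->
  exists P, (forall k, acyc k P) /\
    forall X i, ev (n + i).+1 X M <-> ev i.+1 X P.
Proof.
elim: n M => [|n IH] M Ma; first by exists M.
case: (acyc_emb M) => J [j [jm Ji Ja]]; case: (mono_se HA jm) => N [p jp].
have [P [Pa PE]] := IH N (fun k => acyc_coker jp (Ma k) (Ja k)).
exists P; split=> // X i; rewrite -PE addSn; split=> H.
  exact: (H _ _ _ _ Ji jp).
exact: (ev_shift D Ji jp).
Qed.

Lemma acyc_vanish k n M : (forall l, acyc l M) ->
  (forall j, (j < k)%N -> ev n (L j) M) ->
  forall j m, (j < k)%N -> (n <= m)%N -> ev m (L j) M.
Proof.
move=> Ma; case: n => [|n] Mn j m jk nm.
  case: (Ma k) => M' [M'' [i [p Ms]]]; have pi := splitting_perp Ms Mn.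
  by case: Ms => ip _ M''p; apply: (ev_iso D pi _); apply: M''p.
have [P [Pa PE]] := acyc_shift n Ma.
case: m nm => // m; rewrite ltnS => /subnKC <-; apply/PE.
apply: ev_of_ev1 (Pa k) _ _ _ jk => l lk; apply/PE.
by rewrite addn0; apply: Mn.
Qed.

Section HighestWeight.
Hypothesis socle_split : forall k Q, tors D (below k.+1) Q ->
  (forall j, (j < k)%N -> ev 0 (L j) Q) -> ev 1 (L k) Q.

(** The torsion free quotient of level [k] is acyclic at level [k + 1] too, and
    its part of level [k + 1] is handled by [socle_split]. *)
Lemma splitting_next k M M' M'' (i : hom M' M) (p : hom M M'') :
  acyc k.+1 M -> splitting k i p -> forall n, ev n.+1 (L k) M''.
Proof.
move=> [M1 [M2 [m1 [m2 [m12 M1t M2p]]]]] [ip M't M''p] n.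
have M't1 : tors D (below k.+1) M'.
  by apply: tors_mono M't => l; rewrite /below => /ltnW; rewrite ltnS.
have m2i : m2 \c i = 0 by apply: perp_hom0 M't1 M2p.
case: (se_lift m12 m2i) => t tE.
have tm : mono t.
  by apply: (@mono_compr _ _ _ _ _ m1); rewrite tE; apply: se_mono ip.
case: (mono_se HA tm) => Q [c tc].
have ip' : short_exact (m1 \c t) p by rewrite tE.
case: (se_comp HA tc m12 ip') => a [b [ab _ _]].
have Qt := tors_quot (se_epi tc) M1t.
have M''1 l : (l < k.+1)%N -> ev 1 (L l) M''.
  rewrite ltnS leq_eqVlt => /orP [/eqP ->|lk]; last exact: M''p.
  apply: (ev_mid D ab); last exact: M2p.
  apply: socle_split Qt _ => j jk g; apply: mono_eq0 (se_mono ab) _.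
  exact: (M''p j jk 0).
by apply: (ev_of_ev1 _ M''1) => //; exists Q, M2, a, b.
Qed.

Lemma acyc_next k n M : (forall l, acyc l M) ->
  (forall j, (j < k)%N -> ev n (L j) M) -> ev n.+1 (L k) M.
Proof.
case: n => [|n] Ma Mn.
  case: (Ma k) => M' [M'' [i [p Ms]]]; have pi := splitting_perp Ms Mn.
  by apply: (ev_iso D pi _); apply: splitting_next (Ma k.+1) Ms 0.
have [P [Pa PE]] := acyc_shift n Ma.
have {}Mn j : (j < k)%N -> ev 1 (L j) P.
  by move=> jk; apply/PE; rewrite addn0; apply: Mn.
rewrite -(addn1 n); apply/PE.
case: (Pa k) => P' [P'' [i [p Ps]]].
case: (acyc_emb P) => J [f [fm Ji Ja]]; case: (Ja k) => J' [J'' [u [q Js]]].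
have [s [r rs]] := splitting_retract Ps Js fm Mn.
have P''v := splitting_next (Pa k.+1) Ps; have J''v := splitting_next (Ja k.+1) Js.
case: Ps Js => [ip _ _] [uq _ _]; apply: (ev_mid D ip); last exact: P''v.
by apply: (ev_retract D rs); apply: (ev_left D uq); [apply: J''v | apply: (ev_inj D)].
Qed.

End HighestWeight.

End Vanishing.

End Acyclic.

(** * Filtered objects and sums of copies *)

Section Filtered.
Context {K : fieldType} {C : linCat K} (D : LAplus C).
Implicit Types A B F X Y Z M N T J W P Q : C.
Let HLA : locally_artinian C := LAp_LA D.
Let HA : abelian C := LA_abelian HLA.
Notation L := (simp D).
Notation I := (env D).

Section Closure.
Variable P : C -> Prop.
Hypothesis P0 : forall X, is_zero X -> P X.
Hypothesis Pext : forall X Y Z (i : hom X Y) (p : hom Y Z),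
  short_exact i p -> P X -> P Z -> P Y.
Hypothesis Pun : forall (A : nat -> C) (a : forall n, hom (A n) (A n.+1)) X
    (x : forall n, hom (A n) X),
  (forall n, mono (a n)) -> is_colimit a x -> (forall n, P (A n)) -> P X.

Lemma closed_iso X Y (f : hom X Y) : iso f -> P X -> P Y.
Proof.
move=> fi PX; case: (ab_zero HA) => Z Z0.
exact: Pext (iso_se HA fi Z0) PX (P0 Z0).
Qed.

Lemma chain_quot_closed k (A : nat -> C) (a : forall n, hom (A n) (A n.+1)) M
    (x : forall n, hom (A n) M) Q (q : hom M Q) :
  (forall n, mono (a n)) -> is_colimit a x ->
  (forall n, (k <= n)%N -> exists R (r : hom (A n.+1) R),
    is_cokernel (a n) r /\ P R) ->
  short_exact (x k) q -> P Q.
Proof.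
elim: k A a x => [|k IH] A a x am ax ar xq; last first.
  apply: (IH (fun n => A n.+1) (fun n => a n.+1) (fun n => x n.+1)) => //.
    exact: colim_shift.
  by move=> n kn; apply: ar.
pose f := fix f n : hom (A 0) (A n) :=
  match n with 0 => idm (A 0) | n'.+1 => a n' \c f n' end.
have fm n : mono (f n).
  by elim: n => [|n IH] /=; [apply: iso_mono (iso_id _) | apply: mono_comp].
have fa n : f n.+1 \c idm (A 0) = a n \c f n by rewrite compm1.
case: (chain_coker HLA fa fm) => B [b [g [gb fg]]].
case: (LA_se HLA fa gb fg (colim_const (A 0)) ax) => Z [z [F [G [bz FE GE FG]]]].
have Fx : F = x 0.
  by have := FE 0; rewrite !compm1.
have bse n : exists R (r : hom (B n.+1) R), short_exact (b n) r /\ P R.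
  case: (ar n (leq0n n)) => R [r [rc PR]].
  have arn := coker_se HA (am n) rc.
  case: (se_comp HA (fg n) arn (fg n.+1)) => u [v [uv E _]].
  exists R, v; split=> //; suff -> : b n = u by [].
  by apply: (se_epi (fg n)); rewrite E gb.
have PB n : P (B n).
  elim: n => [|n Bn]; last by case: (bse n) => R [r [br PR]]; apply: Pext br Bn PR.
  apply: P0; apply: epi_zero (se_epi (fg 0)) _.
  by have := se_0 (fg 0); rewrite compm1.
have PZ : P Z by apply: Pun bz PB => n; case: (bse n) => R [r [/se_mono]].
rewrite Fx in FG; case: (se_desc FG (se_0 xq)) => u uE.
case: (se_desc xq (se_0 FG)) => v vE; apply: (closed_iso (f := u) _ PZ); exists v.
by split; [apply: (se_epi FG); rewrite -compA uE vE comp1m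
          |apply: (se_epi xq); rewrite -compA vE uE comp1m].
Qed.

Lemma fil_quot_closed k M (G : filtration M) Q (q : hom M Q) :
  (forall n, (k <= n)%N -> exists R, is_succ_quotient G n.+1 R /\ P R) ->
  short_exact (fil_in G k) q -> P Q.
Proof.
move=> GR; apply: (chain_quot_closed (a := fun n => fil_step G n)).
- exact: fil_step_mono.
- exact: fil_union.
by move=> n /GR [R [[r rc] PR]]; exists R, r.
Qed.

Lemma fil_closed M (G : filtration M) :
  (forall n, exists R, is_succ_quotient G n R /\ P R) -> P M.
Proof.
move=> GR; case: (mono_se HA (@fil_in_mono _ _ _ G 0)) => Q [q Gq].
apply: Pext Gq _ (fil_quot_closed (k := 0) _ Gq); last by move=> n _; apply: GR.
by case: (GR 0) => R [[f [g [gf fg]]] PR]; apply: (closed_iso (f := g)) PR; exists f.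
Qed.

End Closure.

(** A countable sum of copies of [N] is a retract of the union of the finite
    powers of [N]. *)
Lemma sum_closed (P : C -> Prop) N X :
  (forall Z, is_zero Z -> P Z) ->
  (forall X Y Z (i : hom X Y) (p : hom Y Z),
    short_exact i p -> P X -> P Z -> P Y) ->
  (forall (A : nat -> C) (a : forall n, hom (A n) (A n.+1)) X
    (x : forall n, hom (A n) X),
    (forall n, mono (a n)) -> is_colimit a x -> (forall n, P (A n)) -> P X) ->
  (forall X Y (s : hom X Y) (r : hom Y X), r \c s = idm X -> P Y -> P X) ->
  is_sum_of_copies N X -> P N -> P X.
Proof.
move=> P0 Pext Pun Pret [J [i iU]] PN; case: (ab_zero HA) => Z Z0.
pose R (n : nat) Y Y' := exists (b : hom Y Y') (c : hom N Y') p1 p2,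
  is_biproduct b c p1 p2.
have [n Y|Y [Y0 YR]] := @dep_rec (fun _ => obj C) R Z.
  by case: (ab_sum HA Y N) => S [i1 [i2 [p1 [p2 bp]]]]; exists S, i1, i2, p1, p2.
have [b bP] := dep_choice YR; have [c cP] := dep_choice bP.
have [p1 p1P] := dep_choice cP; have [p2 bp] := dep_choice p1P.
have bm n : mono (b n) by apply: se_mono (biproduct_se HA (bp n)).
case: (LA1 HLA b) => V [y by_].
have PV : P V.
  apply: Pun by_ _ => // n; elim: n => [|n IH]; first by apply: P0; rewrite Y0.
  exact: Pext (biproduct_se HA (bp n)) IH PN.
case: (iU V (fun j => y (pickle j).+1 \c c (pickle j))) => s [sE _].
pose t n : hom N X := if unpickle n is Some j then i j else 0.
have [r [_ rE]] := @dep_rec (fun n => hom (Y n) X)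
  (fun n r r' => r' = r \c p1 n + t n \c p2 n) 0
  (fun n r => ex_intro _ _ erefl).
have rb n : r n.+1 \c b n = r n.
  case: (bp n) => E11 E22 E12 E21 _.
  by rewrite rE compDl (postE _ E11) (postE _ E21) comp0r addr0 compm1.
have rc n : r n.+1 \c c n = t n.
  case: (bp n) => E11 E22 E12 E21 _.
  by rewrite rE compDl (postE _ E12) (postE _ E22) comp0r add0r compm1.
case: (colim_desc by_ rb) => u uE; apply: (Pret _ _ s u) PV.
case: (iU X i) => w [_ w1]; rewrite -(w1 (u \c s)).
  by apply: w1 => j; rewrite comp1m.
by move=> j; rewrite -compA sE compA uE rc /t pickleK.
Qed.

Lemma succ_quotient_iso M (G : filtration M) m Q : is_succ_quotient G m Q ->
  (forall m', m = m'.+1 -> is_zero (G m')) -> exists g : hom Q (G m), iso g.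
Proof.
case: m => [[f [g [gf fg]]] _|m [q qc] /(_ m erefl) Gm0].
  by exists g, f.
have Gq := coker_se HA (fil_step_mono (G := G) (n := m)) qc.
by case: (se_zero_l HA Gq Gm0) => g [gq qg]; exists g, q.
Qed.

(** * The objects nabla and the injectives are acyclic *)

Lemma extended_tors n X : extended_nabla D n X -> tors D (below n.+1) X.
Proof.
case=> G GQ; apply: (fil_closed (P := tors D (below n.+1)) _ _ _ (G := G)).
- by move=> Z; apply: tors_zero.
- by move=> A B F i p; apply: tors_ext.
- by move=> A a Y x _; apply: tors_colim.
move=> m; case: (GQ m) => Q [GQm [J [i iU]]]; exists Q; split=> //.
move=> l ln f; case: (iU (I l) (fun _ => 0)) => u [_ u1].
rewrite -(u1 f); first by apply: u1 => j; rewrite comp0l.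
by move=> j; apply: (nabla_tors ln).
Qed.

Section EvClosure.
Variables (n j : nat).

Lemma ev_filtration_quot k M (G : filtration M) Q (q : hom M Q) :
  (forall m, (k <= m)%N -> exists R, is_succ_quotient G m.+1 R /\ ev n (L j) R) ->
  short_exact (fil_in G k) q -> ev n (L j) Q.
Proof.
apply: (fil_quot_closed (P := fun Y => ev n (L j) Y)).
- by move=> X; apply: (ev_zero D).
- by move=> X Y Z f p fp; apply: (ev_mid D fp).
- by move=> A a X x; apply: (ev_union D (simp_fl D j)).
Qed.

Lemma ev_sum N X : is_sum_of_copies N X -> ev n (L j) N -> ev n (L j) X.
Proof.
apply: (sum_closed (P := fun Y => ev n (L j) Y)).
- by move=> Y; apply: (ev_zero D).
- by move=> Y Z W f p fp; apply: (ev_mid D fp).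
- by move=> A a Y x; apply: (ev_union D (simp_fl D j)).
- by move=> Y Z s r rs; apply: (ev_retract D rs).
Qed.

Lemma ev_extended m X : ev n (L j) (nabla D m) -> extended_nabla D m X ->
  ev n (L j) X.
Proof.
move=> Nv [G GQ]; apply: (fil_closed (P := fun Y => ev n (L j) Y) _ _ _ (G := G)).
- by move=> Y; apply: (ev_zero D).
- by move=> Y Z W f p fp; apply: (ev_mid D fp).
- by move=> A a Y x; apply: (ev_union D (simp_fl D j)).
by move=> l; case: (GQ l) => Q [GQl Qsum]; exists Q; split=> //; apply: ev_sum Qsum Nv.
Qed.

End EvClosure.

(** Such a [Q] has its factors among the [L j], [j <= m], but embeds into [X]
    modulo the [m]-th canonical subobject, whose socle has none of these. *)
Lemma canonical_quotient_zero X (G : filtration X) m n Q (q : hom (G m.+1) Q) :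
  canonical D G -> is_cokernel (fil_step G m) q -> extended_nabla D n Q ->
  (n <= m)%N -> is_zero Q.
Proof.
move=> Gc qc Qn nm.
have Gq := coker_se HA (fil_step_mono (G := G) (n := m)) qc.
case: (mono_se HA (@fil_in_mono _ _ _ G m.+1)) => R [r Gr].
case: (mono_se HA (@fil_in_mono _ _ _ G m)) => W [w Gw].
have Gw' : short_exact (fil_in G m.+1 \c fil_step G m) w.
  by case: (fil_union G) => -> _.
case: (se_comp HA Gq Gr Gw') => a [b [ab _ _]].
apply: mono_zero (se_mono ab) _; apply: (tors_hom0 a (extended_tors Qn)).
move=> j; rewrite /below ltnS => jn g.
exact: canon_quot (Gc m) Gw (leq_trans jn nm).
Qed.

Section HW1.
Hypothesis hw1 : HW1 D.

Lemma ev_env_quot i : (forall n j, (j < n)%N -> ev i (L j) (nabla D n)) ->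
  forall n (G : filtration (I n)) k j Q (q : hom (I n) Q),
  canonical D G -> good D G -> (j <= k)%N -> short_exact (fil_in G k) q ->
  ev i (L j) Q.
Proof.
move=> Nu n G k j Q q Gc Gg jk.
apply: ev_filtration_quot => m km; case: (Gg m.+1) => n' [R [GR Rn]]; exists R; split=> //.
case: (leqP n' m) => [nm|mn].
  apply: (ev_zero D); case: GR => r rc.
  exact: canonical_quotient_zero Gc rc Rn nm.
by apply: ev_extended Rn; apply: Nu; apply: leq_ltn_trans mn; apply: leq_trans km.
Qed.

(** The first nonzero term of the canonical filtration of [I n] is an extended
    [nabla n], and its own first nonzero layer [H t] is a nonempty sum of copies of
    [nabla n]. Everything in [I n] above [H t] is filtered by objects [nabla m]
    with [m >= n], so shifting along [H t -> I n] raises the degree by one. *)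
Lemma nabla_ev i n j : (j < n)%N -> ev i (L j) (nabla D n).
Proof.
have nabla0 n' j' : (j' < n')%N -> ev 0 (L j') (nabla D n').
  move=> jn f; case: (nabla_simp D n') => l [_ vm _].
  apply: mono_eq0 vm _; apply: contrapT => /simp_env E.
  by rewrite E ltnn in jn.
elim: i n j => [|i IH] n j jn; first exact: nabla0.
case: (hw1 n) => G Gc Gg.
have [n' [Q [GQ [H HQ]]]] := Gg n.
have [g gi] : exists g : hom Q (G n), iso g.
  apply: (succ_quotient_iso GQ) => m nm.
  apply: mono_zero (@fil_in_mono _ _ _ G m) _.
  by case: (Gc m) => _ /in_Cle_tors Gt _; apply: Gt; rewrite /below nm ltnn.
case: (mono_se HA (@fil_in_mono _ _ _ G n)) => R [c Gc'].
have Ru k : (k <= n)%N -> ev i (L k) R.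
  by move=> kn; apply: ev_env_quot IH _ _ _ _ _ _ Gc Gg kn Gc'.
have [g' [g'g gg']] := gi.
have chi : short_exact (fil_in G n \c g) c.
  apply: (seI HA).
  - by rewrite compA (se_0 Gc') comp0l.
  - by apply: mono_comp (iso_mono gi); apply: se_mono Gc'.
  - exact: se_epi Gc'.
  move=> T t /(se_lift Gc') [u uE]; exists (g' \c u).
  by rewrite -compA (compA g) gg' comp1m.
have Qn0 : ~ is_zero Q.
  move=> Q0; case: (Gc n) => _ _ /(_ _ (env_in D n)) [||h hE].
  - exact: env_in_mono.
  - by apply: fl_in_Cle (simp_fl D n) _; apply: tors_simp; rewrite /below.
  apply: (@env_in_neq0 _ _ D n); rewrite -hE -[h]comp1m -gg' (zero_src g Q0).
  by rewrite !comp0l comp0r.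
have Hn0 : exists t, `[< ~ is_zero (H t) >].
  apply: contrapT => N; apply: Qn0; apply/zeroP; apply: (colim_ext (fil_union H)).
  move=> t; rewrite comp0l comp1m; apply: zero_src.
  by apply: contrapT => Ht; apply: N; exists t; apply/asboolP.
case: (ex_minnP Hn0) => t /asboolP Ht tmin.
have [Qt [HQt [J [inc incU]]]] := HQ t.
have [e ei] : exists e : hom Qt (H t), iso e.
  apply: (succ_quotient_iso HQt) => m tm; apply: contrapT => Hm.
  have /tmin : `[< ~ is_zero (H m) >] by apply/asboolP.
  by rewrite tm ltnn.
have [j0] : inhabited J.
  apply: contrapT => N; apply: Ht; apply: epi_zero (iso_epi ei) _.
  case: (incU (H t) (fun _ => 0)) => w [_ w1].
  rewrite -(w1 e); last by move=> j0; case: N; exists.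
  by apply: w1 => j0; case: N; exists.
case: (incU (nabla D n') (fun j1 => if j1 == j0 then idm _ else 0)) => rho [rhoE _].
have rhoi : rho \c inc j0 = idm _ by rewrite rhoE eqxx.
have incm : mono (inc j0).
  by apply: (@mono_compr _ _ _ _ _ rho); rewrite rhoi; apply: iso_mono (iso_id _).
have Htm : mono (fil_in G n \c g \c fil_in H t).
  by apply: mono_comp (se_mono chi) _; apply: fil_in_mono.
have nn : n' = n.
  case: (nabla_simp D n') => l [vl _ _].
  have lm : mono l.
    apply: (@mono_compr _ _ _ _ _ (nabla_in D n')); rewrite vl.
    exact: env_in_mono.
  have am := mono_comp Htm (mono_comp (iso_mono ei) (mono_comp incm lm)).
  apply: (simp_env (f :=
    fil_in G n \c g \c fil_in H t \c (e \c (inc j0 \c l)))) => E.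
  by have [+ _] := simp_simple D n'; apply; apply: mono_zero am E.
subst n'.
have [e' [e'e ee']] := ei.
apply: (@ev_retract _ _ D _ _ _ (H t) (e \c inc j0) (rho \c e')).
  by rewrite compA -(compA rho) e'e compm1.
case: (mono_se HA Htm) => W [w tw].
apply: (ev_left D tw); last by apply: (ev_inj D); apply: env_inj.
case: (mono_se HA (@fil_in_mono _ _ _ H t)) => V [v Hv].
case: (se_comp HA Hv chi tw) => a [b [ab _ _]].
apply: (ev_mid D ab); last by apply: (Ru j (ltnW jn)).
apply: ev_filtration_quot Hv => l _.
case: (HQ l.+1) => U [HU Usum]; exists U; split=> //.
exact: ev_sum Usum (IH n j jn).
Qed.

Lemma acyc_env k n : acyc D k (I n).
Proof.
case: k => [|k]; first by apply: acyc_perp => j.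
case: (hw1 n) => G Gc Gg; case: (mono_se HA (@fil_in_mono _ _ _ G k)) => Q [q Gq].
exists (G k), Q, (fil_in G k), q; split=> //.
  by case: (Gc k) => _ /in_Cle_tors.
move=> j; rewrite ltnS => jk m.
exact: (ev_env_quot (@nabla_ev m) Gc Gg jk Gq).
Qed.

Lemma acyc_good M (G : filtration M) : good D G -> forall k, acyc D k M.
Proof.
move=> Gg k; apply: (fil_closed (P := acyc D k) _ _ _ (G := G)).
- by move=> X; apply: acyc_zero.
- by move=> X Y Z i p; apply: acyc_ext.
- by move=> A a X x; apply: acyc_union.
move=> m; case: (Gg m) => n [Q [GQ Qn]]; exists Q; split=> //.
case: (leqP k n) => [kn|nk].
  apply: acyc_perp => j jk i.
  exact: ev_extended (nabla_ev i (leq_trans jk kn)) Qn.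
apply: acyc_tors; apply: tors_mono (extended_tors Qn) => l.
by rewrite /below => ln; apply: leq_ltn_trans nk.
Qed.

Lemma acyc_embedding X : exists J (j : hom X J),
  [/\ mono j, injective_obj J & forall k, acyc D k J].
Proof.
apply: (emb (D := D) (P := fun J => forall k, acyc D k J)).
- by move=> Z Z0 k; apply: acyc_zero.
- by move=> m k; apply: acyc_env.
- by move=> A B F i p ip Aa Fa k; apply: acyc_ext ip (Aa k) (Fa k).
- by move=> A a Y x am ax Aa k; apply: (acyc_union am ax) => n.
Qed.

End HW1.

(** * Highest weight categories *)

Section HW2.
Hypothesis hw2 : HW2 D.

Lemma nabla_extends j k : (j <= k)%N -> extends (L j) (nabla D k).
Proof.
move=> jk; have vm : mono (nabla_in D k) by case: (hw2 k).
case: (mono_se HA vm) => Q [q vq].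
apply: (lift_extends (@env_inj _ _ D k) vq) => f; exists 0.
by rewrite (canon_quot f (hw2 k) vq jk) comp0r.
Qed.

(** An object of finite length with factors [L j], [j <= k], and socle a sum of
    copies of [L k] embeds into a sum of copies of [nabla k]; as [L k] occurs in
    [nabla k] only as the socle, any quotient [L k] comes from the socle. The
    induction on the length avoids the sum by mapping to one copy and passing to
    the kernel. *)
Lemma fl_section l k F (f : hom F (L k)) : has_length l F ->
  tors D (below k.+1) F -> (forall j, (j < k)%N -> ev 0 (L j) F) ->
  f <> 0 -> exists s : hom (L k) F, f \c s <> 0.
Proof.
elim/ltn_ind: l F f => l IH F f Fl Ft F0 f0.
have [m m0] : exists m : hom (L k) F, m <> 0.
  apply: contrapT => N; apply: f0; rewrite -[f]compm1.
  suff -> : idm F = 0 by rewrite comp0r.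
  apply: (tors_hom0 _ Ft) => j; rewrite /below ltnS leq_eqVlt => /orP [/eqP -> h|jk].
    by apply: contrapT => h0; apply: N; exists h.
  exact: F0.
case: (pselect (f \c m = 0)) => [fm|fm]; last by exists m.
have mm := simple_mono HLA (simp_simple D k) m0.
case: (nabla_simp D k) => b [vb vm kill].
case: (mono_se HA mm) => Q [q mq].
have [|g gm] := baer (M := nabla D k) (tors_quot (se_epi mq) Ft) _ mq b.
  by move=> j; rewrite /below ltnS; apply: nabla_extends.
have b0 : b <> 0.
  by move=> b0; apply: (@env_in_neq0 _ _ D k); rewrite -vb b0 comp0r.
case: (ab_ker HA g) => A [a ak]; have am := kernel_mono ak; case: ak => ga gU.
case: (pselect (f \c a = 0)) => [fa|fa]; last first.
  case: (length_sub HLA am Fl) => [ai|[l' ll Al]].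
    case: b0; rewrite -gm; suff -> : g = 0 by rewrite comp0l.
    exact: epi_eq0 (iso_epi ai) ga.
  have [|s sE] := IH l' ll A (f \c a) Al (tors_sub am Ft) _ fa.
    by move=> j jk h; apply: mono_eq0 am _; apply: F0.
  by exists (a \c s); rewrite compA.
(* Since [f] kills the kernel of [g] and the socle [L k], it factors through
   [nabla k] modulo its socle, which has no factor [L k]. *)
have [|phi phiE] := inj_factor HA (r := g) (f := env_in D k \c f) (@env_inj _ _ D k).
  by move=> T t gt; case: (gU _ t gt) => u [<- _]; rewrite compA (postE _ fa) comp0r comp0l.
case: f0; apply: mono_eq0 (@env_in_mono _ _ D k) _.
rewrite -phiE (kill k phi) ?comp0l // -gm compA phiE -compA fm comp0r //.
Qed.

Lemma socle_split k Q : tors D (below k.+1) Q ->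
  (forall j, (j < k)%N -> ev 0 (L j) Q) -> ev 1 (L k) Q.
Proof.
move=> Qt Q0; case: (enough_inj D Q) => J [N [i [p [Ji ip]]]].
apply: (ev1I D Ji ip) => f; case: (pullback HA p f) => P [a [b pb]].
case: (pullback_se HA ip pb) => c [cb _].
have Lt : tors D (below k.+1) (L k) by apply: tors_simp; rewrite /below.
have Pt := tors_ext cb Qt Lt.
have P0 j : (j < k)%N -> ev 0 (L j) P.
  move=> jk; apply: (ev_mid D cb); first exact: Q0.
  move=> h; apply: contrapT => h0.
  have /simp_env E : env_in D k \c h <> 0.
    by move/(mono_eq0 (@env_in_mono _ _ D k)).
  by rewrite E ltnn in jk.
have Ss := simp_simple D k.
have [F [h [Ffl hm bh]]] : exists F (h : hom F P),
    [/\ finite_length F, mono h & b \c h <> 0].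
  apply: contrapT => E; have [+ _] := Ss; apply; apply: epi_zero (se_epi cb) _.
  apply: (fl_test HLA) => F h Ffl hm; apply: contrapT => bh; apply: E.
  by exists F, h.
have [l Fl] := fl_length Ffl.
have [|s sE] := fl_section Fl (tors_sub hm Pt) _ bh.
  by move=> j jk g; apply: mono_eq0 hm _; apply: P0.
have [w [_ sw]] := schur HLA Ss Ss sE.
exists (a \c (h \c (s \c w))); case: pb => pf _.
by rewrite compA pf -compA !compA -!(compA f) sw compm1.
Qed.

End HW2.

End Filtered.

Lemma MinP (P : nat -> Prop) n : Min P = Some n -> P n.
Proof.
rewrite /Min; case: pselect => // h [<-]; by case: ex_minnP => m /asboolP.
Qed.

Lemma Min_le (P : nat -> Prop) n : P n -> le_natbar (Min P) (Some n).
Proof.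
move=> Pn; rewrite /Min; case: pselect => [h|[]].
  by case: ex_minnP => m _ mmin; apply: mmin; apply/asboolP.
by exists n; apply/asboolP.
Qed.

Lemma mseq_vanish (K : fieldType) (C : linCat K) (D : LAplus C) (M : C) k n j :
  HW1 D -> (forall l, acyc D l M) ->
  le_natbar (mseq D M k) (Some n) -> (j <= k)%N -> ev n (simp D j) M.
Proof.
move=> hw1 Ma; elim: k n j => [|k IH] n j.
  case E : (mseq D M 0) => [m|//] /= mn; rewrite leqn0 => /eqP ->.
  have /(Ext_zeroP D) Mm := MinP E.
  apply: (acyc_vanish (acyc_embedding hw1) Ma (k := 1) (n := m)) => // l.
  by rewrite ltnS leqn0 => /eqP ->.
case E : (mseq D M k.+1) => [m|//] mn jk.
have [km /(Ext_zeroP D) Mm] := MinP E.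
apply: (acyc_vanish (acyc_embedding hw1) Ma (k := k.+2) (n := m)) => // l.
by rewrite ltnS leq_eqVlt => /orP [/eqP -> //|]; rewrite ltnS; apply: IH.
Qed.

Theorem theorem6 (K : fieldType) (charK0 : [pchar K]%R =i pred0)
    (C : linCat K) (D : LAplus C) (HD : generalized_HW_category D)
    (M : C) (HM : exists G : filtration M, good D G) :
  (forall k n : nat, le_natbar (mseq D M k) (Some n) ->
     Ext_zero n (simp D k) M) /\
  (HW_category D ->
     [/\ le_natbar (mseq D M 0) (Some 1%N),
         forall k : nat,
           le_natbar (mseq D M k.+1) (succ_natbar (mseq D M k))
       & forall k : nat, mseq D M k <> None]).
Proof.
case: HM => G Gg; have Ma := acyc_good HD Gg.
split=> [k n kn|[_ hw2]].
  by apply/(Ext_zeroP D); apply: mseq_vanish HD Ma kn (leqnn k).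
have next := acyc_next (acyc_embedding HD) (socle_split hw2) Ma.
have m0 : le_natbar (mseq D M 0) (Some 1%N).
  by apply: Min_le; apply/(Ext_zeroP D); apply: next.
have mS k : le_natbar (mseq D M k.+1) (succ_natbar (mseq D M k)).
  case E : (mseq D M k) => [m|] /=; last by case: Min.
  apply: Min_le; split; first by rewrite E /=.
  apply/(Ext_zeroP D); apply: next => j; rewrite ltnS => jk.
  by apply: mseq_vanish HD Ma _ jk; rewrite E /=.
split=> // k; elim: k => [|k IH] E; first by rewrite E in m0.
by case F : (mseq D M k) => [m|//]; have := mS k; rewrite F E.
Qed.
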